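(* Let $M$ be an affine algebraic monoid over an algebraically closed field $\Bbbk$, with unit group $G$, and let $H\subset G$ be a normal subgroup that is closed in $M$. Then the action $H\times M\to M$ by left multiplication is observable. Moreover, if $\Bbbk[M]^H$ is finitely generated, then the affinized quotient $M/_{\operatorname{aff}}H$ is an affine algebraic monoid with unit group $G/H$.
   Context: An algebraic monoid is an algebraic variety $M$ with an associative product $M\times M\to M$ that is a morphism of varieties and has a neutral element $1$. Its unit group $G=G(M)$ is an algebraic group, open in $M$. $H$ acts on $\Bbbk[M]$ on the right by $(f\cdot h)(m)=f(hm)$, and $\Bbbk[M]^H$ is the algebra of invariants. The action of $H$ on $M$ is observable if every nonzero $H$-stable ideal $I\subset\Bbbk[M]$ satisfies $I^H\neq(0)$. When $\Bbbk[M]^H$ is finitely generated, the affinized quotient is the morphism $\pi:M\to M/_{\operatorname{aff}}H=\operatorname{Spec}\bigl(\Bbbk[M]^H\bigr)$ induced by the inclusion $\Bbbk[M]^H\subset\Bbbk[M]$. The monoid structure on $M/_{\operatorname{aff}}H$ is the one induced from $M$ (the comultiplication of $\Bbbk[M]$ restricted to $\Bbbk[M]^H$).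
   Formalization: Varieties may be reducible here, and every irreducible component of M is assumed to contain a unit (automatic if M is irreducible); without this the claim fails, e.g. for M = G_m ⊔ A^1 with G_m scaling A^1, st = 0 for s, t in A^1, and H = G_m. *)

(* Defs.v *)
From mathcomp Require Import all_boot all_algebra.
From mathcomp Require Import boolp classical_sets.

Set Implicit Arguments.
Unset Strict Implicit.
Unset Printing Implicit Defensive.

Import GRing.Theory.
Local Open Scope classical_set_scope.
Local Open Scope ring_scope.

(* Affine varieties are treated classically, as a set of points together with
   an algebra of k-valued functions: [(X, k[X])] is an affine variety when
   [k[X]] is finitely generated and the points of [X] are exactly the
   k-algebra homomorphisms [k[X] -> k].  Such pairs are, up to isomorphism,
   the Zariski closed subsets of the affine spaces with their polynomial
   functions; varieties may be reducible. *)

Section FunctionAlgebras.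
Variables (k : closedFieldType) (T : Type).
Implicit Types A : set (T -> k).

Definition subalgebra A : Prop :=
  [/\ forall c : k, A (fun=> c),
      forall f g, A f -> A g -> A (f \+ g) &
      forall f g, A f -> A g -> A (f \* g)].

Definition finitely_generated A : Prop :=
  exists (n : nat) (g : 'I_n -> T -> k), A = smallest subalgebra (range g).

(* The first clause gives [phi 1 = 1] and, with the third, k-linearity. *)
Definition alghom A (phi : A -> k) : Prop :=
  [/\ forall (c : k) (f : A), val f = (fun=> c) -> phi f = c,
      forall f g s : A, val s = val f \+ val g -> phi s = phi f + phi g &
      forall f g p : A, val p = val f \* val g -> phi p = phi f * phi g].

End FunctionAlgebras.

Record funSpace (k : closedFieldType) := FunSpace {
  point :> Type;
  reg : set (point -> k)
}.
Arguments FunSpace {k} point reg.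
Arguments reg {k} X : rename.

Section Varieties.
Variable k : closedFieldType.
Implicit Types X Y : funSpace k.

Definition affine_variety X : Prop :=
  [/\ subalgebra (reg X), finitely_generated (reg X) &
      forall phi : reg X -> k, alghom phi ->
        exists! x : X, forall f : reg X, phi f = val f x].

(* [k[X x Y]] is [k[X] (x) k[Y]], viewed as functions on [X * Y]. *)
Definition prod_space X Y : funSpace k :=
  FunSpace (X * Y)%type
    [set f | exists (n : nat) (a : 'I_n -> reg X) (b : 'I_n -> reg Y),
       forall p, f p = \sum_(i < n) val (a i) p.1 * val (b i) p.2].

Definition morphism X Y (p : X -> Y) : Prop :=
  forall f, reg Y f -> reg X (f \o p).

Definition zclosed X (Z : set X) : Prop :=
  exists2 S : set (X -> k),
    S `<=` reg X & Z = [set x | forall f, S f -> f x = 0].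

Definition zopen X (U : set X) : Prop := zclosed (~` U).

Definition irreducible X (Z : set X) : Prop :=
  Z !=set0 /\ forall Z1 Z2 : set X, zclosed Z1 -> zclosed Z2 ->
    Z `<=` Z1 `|` Z2 -> Z `<=` Z1 \/ Z `<=` Z2.

Definition irreducible_component X (Z : set X) : Prop :=
  irreducible Z /\ forall Z' : set X, irreducible Z' -> Z `<=` Z' -> Z' = Z.

(* [f] is a section over [U] of the structure sheaf of [X]; the values of [f]
   outside [U] are irrelevant. *)
Definition regular_on X (U : set X) (f : X -> k) : Prop :=
  forall x, U x -> exists a b : X -> k,
    [/\ reg X a, reg X b, b x != 0 &
        forall y, U y -> b y != 0 -> f y = a y / b y].

(* The maximal spectrum of an algebra of functions: its points are the
   k-algebra homomorphisms [A -> k], and the elements of [A] act on them by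
   evaluation. *)
Definition spec (T : Type) (A : set (T -> k)) : funSpace k :=
  FunSpace {phi : A -> k | alghom phi}
    (range (fun (f : A) (phi : {phi : A -> k | alghom phi}) => sval phi f)).

Lemma alghom_ev (T : Type) (A : set (T -> k)) (x : T) :
  alghom (fun f : A => val f x).
Proof. by split=> [c f ->|f g s ->|f g s ->]. Qed.

Definition spec_ev (T : Type) (A : set (T -> k)) (x : T) : spec A :=
  exist _ _ (alghom_ev A x).

End Varieties.

Section Monoids.
Variable k : closedFieldType.

Definition affine_monoid (M : funSpace k) (mul : M -> M -> M) (one : M) :
    Prop :=
  [/\ affine_variety M, associative mul, left_id one mul, right_id one mul &
      @morphism k (prod_space M M) M (fun p => mul p.1 p.2)].

Definition unit_group (T : Type) (mul : T -> T -> T) (one : T) : set T :=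
  [set x | exists y, mul x y = one /\ mul y x = one].

Definition normal_subgroup (T : Type) (mul : T -> T -> T) (one : T)
    (H : set T) : Prop :=
  [/\ H `<=` unit_group mul one, H one,
      forall x y, H x -> H y -> H (mul x y),
      forall x y, H x -> mul x y = one -> mul y x = one -> H y &
      forall g g' x, mul g g' = one -> mul g' g = one -> H x ->
        H (mul (mul g x) g')].

End Monoids.

Section Actions.
Variables (k : closedFieldType) (X : funSpace k) (G : Type).
Variables (act : G -> X -> X) (H : set G).

Definition invariants : set (X -> k) :=
  [set f | reg X f /\ forall h, H h -> f \o act h = f].

Definition ideal (I : set (X -> k)) : Prop :=
  [/\ I `<=` reg X, I (fun=> 0),
      forall f g, I f -> I g -> I (f \+ g) &
      forall a f, reg X a -> I f -> I (a \* f)].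

Definition stable (I : set (X -> k)) : Prop :=
  forall h f, H h -> I f -> I (f \o act h).

Definition observable : Prop :=
  forall I : set (X -> k), ideal I -> stable I ->
    (exists2 f, I f & f <> (fun=> 0)) ->
    exists2 f, (I `&` invariants) f & f <> (fun=> 0).

Definition aff_quotient : funSpace k := spec invariants.

Definition aff_proj : X -> aff_quotient := spec_ev invariants.

End Actions.

Section MonoidQuotient.
Variable k : closedFieldType.

(* [mulQ] is dual to the restriction to [k[M]^H] of the comultiplication
   [f |-> \sum_i a_i (x) b_i], where [f (x y) = \sum_i a_i x * b_i y]; that the
   comultiplication maps [k[M]^H] to [k[M]^H (x) k[M]^H] is part of it. *)
Definition induced_product (M : funSpace k) (mul : M -> M -> M) (H : set M)
    (mulQ : aff_quotient mul H -> aff_quotient mul H -> aff_quotient mul H) :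
    Prop :=
  forall f : invariants mul H,
    exists (n : nat) (a b : 'I_n -> invariants mul H),
      (forall x y, val f (mul x y) = \sum_(i < n) val (a i) x * val (b i) y) /\
      (forall phi psi : aff_quotient mul H,
         sval (mulQ phi psi) f = \sum_(i < n) sval phi (a i) * sval psi (b i)).

(* [p] identifies the unit group of [N] with the algebraic group [G/H], where
   [G] is the unit group of [M]: it is a surjective homomorphism [G -> G(N)]
   whose fibres are the cosets of [H], and [G(N)] carries the quotient topology
   and the quotient sheaf (a function on an open [V] is regular iff its
   pullback to the inverse image of [V] in [G] is).  As [G] and [G(N)] are open,
   their open subsets are those of [M] and [N] which they contain. *)
Definition unit_group_quotient (M N : funSpace k)
    (mul : M -> M -> M) (one : M) (mulN : N -> N -> N) (oneN : N)
    (H : set M) (p : M -> N) : Prop :=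
  let G := unit_group mul one in
  let GN := unit_group mulN oneN in
  [/\ p @` G = GN,
      forall x y, G x -> G y -> p (mul x y) = mulN (p x) (p y),
      forall x y, G x -> G y ->
        (p x = p y <-> exists2 h, H h & x = mul h y),
      forall V, V `<=` GN -> (zopen V <-> zopen (G `&` p @^-1` V)) &
      forall V (f : N -> k), V `<=` GN -> zopen V ->
        (regular_on V f <-> regular_on (G `&` p @^-1` V) (f \o p))].

End MonoidQuotient.

(* Main.v *)
Require Import Defs.
From mathcomp Require Import all_boot all_algebra.
From mathcomp Require Import boolp classical_sets zify ring.

(* Let [B = k[M]], [A = B^H] and [G] the unit group, which is dense by [Mcomp].
   Everything follows from one separation property: if [I] is an [H]-stable ideal
   of [B] and [x] in [G] is not a common zero of [I], then some [f] in [I^H] has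
   [f x != 0].  One may take [x = 1].  As [H] is closed, the Nullstellensatz gives
   [f] in [I] equal to [1] on [H], and Chevalley's determinant trick applied to
   the translates of [f] under [H] produces an [H]-semi-invariant [D] in [I] with
   [D 1 != 0], of some weight [chi].  To cancel the weight, [1/chi] extends to a
   function [q] in [B] because [H] is closed in [M] and not merely in [G]; a
   representation of [M] of least dimension in which the weight [q] still occurs
   in the group algebra of [H] is irreducible, hence spanned by the [G]-translates
   of a vector of weight [q] (Clifford), so its determinant has as weight the
   product of finitely many conjugates of [1/chi], and these are cancelled by
   conjugates of a second semi-invariant of weight [chi].

   Applied with the determinant of a faithful representation of [M] for [chi],
   this gives a character [e] of [M] in [A] vanishing exactly off [G].  Separation
   yields observability, the fibres of [G -> Spec A], its openness, and (for ideals
   of denominators) the structure sheaf.  For surjectivity onto the units of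
   [Spec A], a point [phi] with [1] in [ker phi * B] is excluded by generic
   linear algebra over [A] and translation by [G], and [e] shows that a preimage
   in [M] is a unit. *)

Set Implicit Arguments.
Unset Strict Implicit.
Unset Printing Implicit Defensive.

Import GRing.Theory.
Local Open Scope classical_set_scope.
Local Open Scope ring_scope.

(** * The Nullstellensatz *)

Section RingIdeals.
Variable R : comNzRingType.
Implicit Types (I J P : set R) (a b v : R).

Definition ring_ideal I : Prop :=
  [/\ I 0, forall a b, I a -> I b -> I (a + b) & forall a b, I b -> I (a * b)].

Definition prime_ideal P : Prop :=
  [/\ ring_ideal P, ~ P 1 & forall a b, P (a * b) -> P a \/ P b].

Lemma ring_idealB I a b : ring_ideal I -> I a -> I b -> I (a - b).
Proof. by case=> _ ID IM Ia Ib; apply: ID => //; rewrite -mulN1r; exact: IM. Qed.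

Lemma ring_ideal_sum I (T : Type) (r : seq T) (Q : pred T) (F : T -> R) :
  ring_ideal I -> (forall i, Q i -> I (F i)) -> I (\sum_(i <- r | Q i) F i).
Proof. by case=> I0 ID _; exact: big_ind. Qed.

Lemma prime_idealX P a n : prime_ideal P -> P (a ^+ n) -> P a.
Proof.
case=> _ P1 Pp; elim: n => [/P1//|n IHn]; rewrite exprS => /Pp[]//.
Qed.

Lemma ring_ideal_add I v : ring_ideal I ->
  ring_ideal [set x | exists2 a, I a & exists b, x = a + b * v].
Proof.
case=> I0 ID IM; split.
- by exists 0 => //; exists 0; rewrite mul0r addr0.
- move=> _ _ [a Ia [b ->]] [a' Ia' [b' ->]]; exists (a + a'); first exact: ID.
  by exists (b + b'); rewrite mulrDl addrACA.
- move=> c _ [a Ia [b ->]]; exists (c * a); first exact: IM.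
  by exists (c * b); rewrite mulrDr mulrA.
Qed.

(** Take, by Zorn, an ideal maximal among those containing [I] and missing all powers of [v].
    Adjoining [a] or [b] from outside captures a power of [v]; the product of the two powers would
    be captured by [a * b]. *)
Lemma prime_ideal_avoiding I v : ring_ideal I -> (forall n, ~ I (v ^+ n)) ->
  exists P, [/\ prime_ideal P, I `<=` P & ~ P v].
Proof.
move=> Iid Iv.
pose Q X := X = set0 \/ [/\ ring_ideal X, I `<=` X & forall n, ~ X (v ^+ n)].
have [F FQ Ftot|P [QP Pmax]] := @Zorn_bigcup R Q.
  have [[X [FX X0]]|noX] := pselect (exists X, F X /\ X <> set0); last first.
    left; apply/seteqP; split => // x [X FX Xx]; case: noX; exists X; split => //.
    by move=> X0; rewrite X0 in Xx.
  have good Y y : F Y -> Y y ->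
      [/\ ring_ideal Y, I `<=` Y & forall n, ~ Y (v ^+ n)].
    by move=> FY Yy; case: (FQ _ FY) => // Y0; rewrite Y0 in Yy.
  have [x Xx] : X !=set0 by apply: contrapT => /nonemptyPn.
  have [[Xz _ _] IX _] := good _ _ FX Xx.
  right; split; [split| |].
  - by exists X.
  - move=> a b [Y FY Ya] [Z FZ Zb].
    have [sub|sub] := Ftot _ _ FY FZ.
      by exists Z => //; have [[_ ZD _] _ _] := good _ _ FZ Zb; apply: ZD => //; exact: sub.
    by exists Y => //; have [[_ ZD _] _ _] := good _ _ FY Ya; apply: ZD => //; exact: sub.
  - move=> a b [Y FY Yb]; exists Y => //.
    by have [[_ _ YM] _ _] := good _ _ FY Yb; exact: YM.
  - by move=> y Iy; exists X => //; exact: IX.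
  - by move=> n [Y FY Yv]; have [_ _ /(_ n)] := good _ _ FY Yv.
have [I0 _ _] := Iid.
case: QP => [P0|[Pid IP Pv]].
  exfalso; apply: (Pmax I); last by right; split.
  by rewrite P0; split => // /(_ 0 I0).
exists P; split => //; last by have := Pv 1%N; rewrite expr1.
have grow a : ~ P a -> exists n b, P (v ^+ n - b * a).
  move=> Pa; apply: contrapT => non.
  pose J := [set x | exists2 p, P p & exists b, x = p + b * a].
  have [P0 _ _] := Pid.
  have PJ : P `<=` J by move=> p Pp; exists p => //; exists 0; rewrite mul0r addr0.
  apply: (Pmax J).
    split=> // /(_ a) JP; apply/Pa/JP; exists 0 => //.
    by exists 1; rewrite mul1r add0r.
  right; split; first exact: ring_ideal_add.
    by move=> x /IP/PJ.
  by move=> n [p Pp [b vE]]; apply: non; exists n, b; rewrite vE addrK.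
split => //; first by have := Pv 0; rewrite expr0.
move=> a b Pab; apply: contrapT => /not_orP[/grow[n [c Pa]] /grow[m [d Pb]]].
have [_ PD PM] := Pid.
apply: (Pv (n + m)%N); rewrite exprD.
rewrite -[v ^+ n](subrK (c * a)) -[v ^+ m](subrK (d * b)) mulrDl.
apply: (PD); first by rewrite mulrC; exact: PM.
rewrite mulrDr; apply: PD; first exact: PM.
by rewrite mulrACA; exact: PM.
Qed.

End RingIdeals.

Section PolyIdeals.
Variable R : idomainType.
Implicit Types (P J : set {poly R}) (f g r : {poly R}).

Lemma coefs_in_ideal P r : ring_ideal P -> (forall i, P (r`_i)%:P) -> P r.
Proof.
move=> Pid rP; rewrite -[r]coefK poly_def; apply: ring_ideal_sum => // i _.
by have [_ _ PM] := Pid; rewrite -mul_polyC mulrC; exact: PM.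
Qed.

(** Removing the leading term, which lies in [P], leaves a shorter element of [J], so induction on
    the size reaches all coefficients. *)
Lemma small_coefs_in_ideal P J s : ring_ideal P -> ring_ideal J -> P `<=` J ->
  (forall g, J g -> (size g <= s)%N -> P (lead_coef g)%:P) ->
  forall r, J r -> (size r <= s)%N -> forall i, P (r`_i)%:P.
Proof.
move=> Pid Jid PJ Js r; move: {2}(size r) (leqnn (size r)) => n.
have [P0 PD PM] := Pid.
elim: n r => [|n IHn] r.
  by rewrite leqn0 size_poly_eq0 => /eqP-> _ _ i; rewrite coef0.
move=> rn Jr rs i.
have Pl := Js _ Jr rs.
have [r0|r0] := eqVneq r 0; first by rewrite r0 coef0.
pose t := (lead_coef r)%:P * 'X^((size r).-1).
have Pt : P t by rewrite /t mulrC; exact: PM.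
have szt : (size (r - t)%R < size r)%N.
  have sr : (0 < size r)%N by rewrite lt0n size_poly_eq0.
  rewrite /t mul_polyC -[X in (_ < X)%N](prednK sr) ltnS.
  apply/leq_sizeP => j; rewrite leq_eqVlt coefB coefZ coefXn => /predU1P[<-|lj].
    by rewrite eqxx mulr1 subrr.
  by rewrite (gtn_eqF lj) mulr0 subr0 nth_default // -(prednK sr).
have := IHn (r - t) _ _ _ i.
have -> : (r - t)`_i = r`_i - t`_i by rewrite coefB.
have Pti : P (t`_i)%:P.
  rewrite /t coefCM coefXn; case: eqP => _; first by rewrite mulr1.
  by rewrite mulr0.
rewrite polyCB => H; rewrite -[_%:P](subrK (t`_i)%:P); apply: PD => //; apply: H.
- by rewrite -ltnS; apply: leq_trans szt _.
- by apply: ring_idealB => //; exact: PJ.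
- by apply: leq_trans rs; exact: ltnW.
Qed.

Lemma minimal_lead P J : (exists2 f, J f & ~ P (lead_coef f)%:P) ->
  exists f, [/\ J f, ~ P (lead_coef f)%:P &
    forall g, J g -> (size g < size f)%N -> P (lead_coef g)%:P].
Proof.
move=> [f0 Jf0 Pf0].
pose Q n := `[< exists f, [/\ J f, ~ P (lead_coef f)%:P & size f = n] >].
have exQ : exists n, Q n by exists (size f0); apply/asboolP; exists f0.
case: (ex_minnP exQ) => n /asboolP[f [Jf Pf sf]] min_n.
exists f; split => // g Jg; rewrite sf => lg; apply: contrapT => Pg.
have /min_n : Q (size g) by apply/asboolP; exists g.
by rewrite leqNgt lg.
Qed.

End PolyIdeals.

Section Nullstellensatz.
Variable k : closedFieldType.

(* The Nullstellensatz in the Rabinowitsch form, which is what passes from [R]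
   to [R[X]]. *)
Definition nullstellensatz_for (R : comNzRingType) (i : {rmorphism k -> R}) : Prop :=
  forall (I : set R) v, ring_ideal I -> (forall n, ~ I (v ^+ n)) ->
    exists phi : {rmorphism R -> k},
      [/\ forall c, phi (i c) = c, forall a, I a -> phi a = 0 & phi v != 0].

Section PolynomialExtension.
Variables (R : idomainType) (i : {rmorphism k -> R}).
Implicit Types (f g h q r : {poly R}).

(** Replace [I] by a prime [P] avoiding [v], with contraction [p] to [R]. First specialize [R] away
    from a suitable element outside [p], then choose the value of the variable: a nonroot if [P]
    comes from [p], a root of a minimal polynomial otherwise. *)
Lemma nullstellensatz_poly :
  nullstellensatz_for i -> nullstellensatz_for (polyC \o i : {rmorphism k -> {poly R}}).
Proof.
move=> NR I v Iid Iv.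
have [P [Pp IP Pv]] := prime_ideal_avoiding Iid Iv.
suff [phi [phii phiP phiv]] : exists phi : {rmorphism {poly R} -> k},
    [/\ forall c, phi (i c)%:P = c, forall a, P a -> phi a = 0 & phi v != 0].
  by exists phi; split => // a /IP/phiP.
have [Pid P1 Pprime] := Pp; have [P0 PD PM] := Pid.
pose p := [set r : R | P r%:P].
have pid : ring_ideal p.
  split=> [|a b|a b]; rewrite /p /=; first by rewrite polyC0.
    by rewrite polyCD; exact: PD.
  by rewrite polyCM; exact: PM.
have pp : prime_ideal p.
  split => //.
  by move=> a b; rewrite /p /= polyCM => /Pprime.
have NRp u : ~ p u -> exists phi : {rmorphism R -> k},
      [/\ forall c, phi (i c) = c, forall a, p a -> phi a = 0 & phi u != 0].
  by move=> pu; apply: NR => // n /(prime_idealX pp).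
have map0 (phi : {rmorphism R -> k}) (r : {poly R}) : (forall a, p a -> phi a = 0) ->
    (forall j, p r`_j) -> map_poly phi r = 0.
  by move=> phip pr; apply/polyP => j; rewrite coef_map coef0 /= phip.
(* If all leading coefficients lie in [p], so do all coefficients of elements of [P]. A coefficient
   of [v] outside [p] can be kept nonzero, and then the image of [v] has a nonroot. *)
have [noP|] := pselect (forall f : {poly R}, P f -> P (lead_coef f)%:P).
  have [j pj] : exists j, ~ p v`_j.
    apply: contrapT => /forallNP allp; apply: Pv; apply: coefs_in_ideal => // j.
    exact: contrapT (allp j).
  have [phi [phii phip phij]] := NRp _ pj.
  have : map_poly phi v != 0.
    by apply: contraNneq phij => /polyP/(_ j); rewrite coef_map coef0 /= => ->.
  move=> /closed_nonrootP[c rc].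
  exists (horner_eval c \o map_poly phi); split => [d|a Pa|] /=.
  - by rewrite map_polyC /= /horner_eval hornerC.
  - rewrite map0 ?/horner_eval ?horner0 // => l.
    exact: (@small_coefs_in_ideal _ P P (size a) Pid Pid (@subset_refl _ P) (fun g Pg _ => noP g Pg) a).
  - by [].
move=> /existsNP[f0 /not_implyP[Pf0 lf0]].
(* Over the fraction field of [R / p], this is, up to a scalar, the minimal polynomial of the
   variable modulo [P]. *)
have [f [Pf lf minf]] : exists f, [/\ P f, ~ P (lead_coef f)%:P &
    forall g, P g -> (size g < size f)%N -> P (lead_coef g)%:P].
  by apply: minimal_lead; exists f0.
have smallP r : P r -> (size r < size f)%N -> forall j, p r`_j.
  move=> Pr sr; apply: (small_coefs_in_ideal (J := P) (s := size r)) => // g Pg sg.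
  by apply: minf => //; exact: leq_ltn_trans sg sr.
have f0n : f != 0 by apply: contra_notN lf => /eqP->; rewrite lead_coef0.
have szf : (1 < size f)%N.
  rewrite ltnNge; apply: contra_notN lf => /size1_polyC fE.
  by rewrite lead_coefE {2}fE size_polyC; case: (_ != _); rewrite -fE.
pose J := [set x | exists2 a, P a & exists b, x = a + b * v].
have Jid : ring_ideal J by exact: ring_ideal_add.
have PJ : P `<=` J by move=> x Px; exists x => //; exists 0; rewrite mul0r addr0.
have Jv : J v by exists 0 => //; exists 1; rewrite mul1r add0r.
(* Modulo [p], [h] plays the role of the gcd of [f] and [v]; primality of [P] will force it to be
   constant. *)
have [h [Jh lh minh]] : exists h, [/\ J h, ~ P (lead_coef h)%:P &
    forall g, J g -> (size g < size h)%N -> P (lead_coef g)%:P].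
  by apply: minimal_lead; exists f => //; exact: PJ.
have smallJ r : J r -> (size r < size h)%N -> forall j, p r`_j.
  move=> Jr sr; apply: (small_coefs_in_ideal (s := size r) Pid Jid PJ) => // g Jg sg.
  by apply: minh => //; exact: leq_ltn_trans sg sr.
have h0 : h != 0 by apply: contra_notN lh => /eqP->; rewrite lead_coef0.
have [szh|szh] := leqP (size h) 1; last first.
  exfalso.
  have divh g : J g -> exists m q, let r := (lead_coef h ^+ m)%:P * g - q * h in
      [/\ (size r < size h)%N, forall j, p r`_j & P r].
    move=> Jg; have E := Pdiv.ComRing.rdivp_eq h g.
    exists (Pdiv.Ring.rscalp g h), (Pdiv.Ring.rdivp g h).
    rewrite /= mul_polyC E addrC addKr.
    have Jr : J (Pdiv.Ring.rmodp g h).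
      have -> : Pdiv.Ring.rmodp g h = (lead_coef h ^+ Pdiv.Ring.rscalp g h)%:P * g
             - Pdiv.Ring.rdivp g h * h by rewrite mul_polyC E addrC addKr.
      by have [_ _ JM] := Jid; apply: ring_idealB => //; exact: JM.
    have c := smallJ _ Jr (Pdiv.Ring.ltn_rmodpN0 _ h0).
    by split => //; [exact: Pdiv.Ring.ltn_rmodpN0|exact: coefs_in_ideal].
  have lX m : ~ p (lead_coef h ^+ m) by move/(prime_idealX pp).
  (* Here [q * h] is in [P]. If [q] is, it is shorter than [f], so its coefficients and then
     [lead_coef h ^+ m * lead_coef f] fall into [p]; if [h] is, dividing [v] by [h] puts [v] into
     [P]. *)
  have [m [q [sr pr Pr]]] := divh f (PJ _ Pf).
  have : P (q * h).
    rewrite -[q * h](subKr ((lead_coef h ^+ m)%:P * f)).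
    by apply: ring_idealB => //; exact: PM.
  case/Pprime => [Pq|Ph].
    have szfh : (size h <= size f)%N.
      by rewrite leqNgt; apply/negP => /(minh _ (PJ _ Pf)).
    have szqh : (size (q * h)%R <= size f)%N.
      rewrite -[q * h](subKr ((lead_coef h ^+ m)%:P * f)).
      apply: leq_trans (size_polyD _ _) _.
      rewrite size_polyN geq_max (leq_trans (ltnW sr) szfh) andbT.
      by rewrite mul_polyC; exact: size_scale_leq.
    have szq : (size q < size f)%N.
      have [->|q0] := eqVneq q 0; first by rewrite size_poly0 ltnW.
      by apply: leq_trans szqh; rewrite size_mul //; move: szh; case: (size h) => [|[|s]] //=; lia.
    apply: (lX m); have [_ pD pM] := pid.
    have : p (lead_coef h ^+ m * lead_coef f).
      have -> : lead_coef h ^+ m * lead_coef f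
          = ((lead_coef h ^+ m)%:P * f - q * h)`_(size f).-1 + (q * h)`_(size f).-1.
        by rewrite coefB subrK coefCM.
      apply: pD => //; rewrite coefM; apply: ring_ideal_sum => // j _.
      by rewrite mulrC; apply: pM; exact: smallP.
    by have [_ _ H] := pp; move=> /H[].
  have [m' [q' [_ _ Pr']]] := divh v Jv.
  have : P ((lead_coef h ^+ m')%:P * v).
    rewrite -[_ * v](subrK (q' * h)); apply: PD => //; exact: PM.
  by case/Pprime => // /(lX m').
(* As [u] lies in [P + (v)], a specialization killing [P] but not [u] cannot kill [v]. Keeping
   [lead_coef f] nonzero as well preserves the degree of [f], which gives the root [c], and lets
   pseudo-division by [f] show that [P] is killed. *)
have [u hE] : exists u, h = u%:P by exists h`_0; exact: size1_polyC.
have pu : ~ p u by move: lh; rewrite hE lead_coefC.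
have pul : ~ p (u * lead_coef f) by have [_ _ H] := pp; move/H => [].
have [phi [phii phip]] := NRp _ pul.
rewrite rmorphM mulf_eq0 negb_or => /andP[phiu phil].
have : size (map_poly phi f) != 1%N by rewrite size_map_poly_id0 // gtn_eqF.
move=> /closed_rootP[c /rootP rc].
have kP a : P a -> (map_poly phi a).[c] = 0.
  move=> Pa; have E := Pdiv.ComRing.rdivp_eq f a.
  have Pr : P (Pdiv.Ring.rmodp a f).
    have -> : Pdiv.Ring.rmodp a f = (lead_coef f ^+ Pdiv.Ring.rscalp a f)%:P * a
             - Pdiv.Ring.rdivp a f * f by rewrite mul_polyC E addrC addKr.
    by apply: ring_idealB => //; exact: PM.
  have c0 := map0 _ _ phip (smallP _ Pr (Pdiv.Ring.ltn_rmodpN0 _ f0n)).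
  move/(congr1 (fun g => (map_poly phi g).[c])): E.
  rewrite rmorphD rmorphM /= c0 addr0 hornerM rc mulr0 map_polyZ /= hornerZ rmorphXn.
  by move/eqP; rewrite mulf_eq0 expf_eq0 (negPf phil) andbF /= => /eqP.
exists (horner_eval c \o map_poly phi); split => [d|a Pa|] /=.
- by rewrite map_polyC /= /horner_eval hornerC.
- exact: kP.
- rewrite /horner_eval; have [a Pa [b hab]] := Jh.
  apply: contraNneq phiu => v0.
  move/(congr1 (fun g => (map_poly phi g).[c])): hab.
  by rewrite hE map_polyC hornerC /= rmorphD rmorphM hornerD hornerM kP // v0 mulr0 addr0 => ->.
Qed.

End PolynomialExtension.

End Nullstellensatz.

(** * Closure properties of algebras of functions *)

Section Subalgebras.
Variables (k : closedFieldType) (T : Type) (A : set (T -> k)).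
Hypothesis Aalg : subalgebra A.

Lemma subalg_eq f g : A f -> f =1 g -> A g.
Proof. by move=> Af /funext<-. Qed.

Lemma subalg_cst c : A (fun=> c).
Proof. by have [Ac _ _] := Aalg. Qed.

Lemma subalgD f g : A f -> A g -> A (fun x => f x + g x).
Proof. by have [_ AD _] := Aalg; exact: AD. Qed.

Lemma subalgM f g : A f -> A g -> A (fun x => f x * g x).
Proof. by have [_ _ AM] := Aalg; exact: AM. Qed.

Lemma subalgZ c f : A f -> A (fun x => c * f x).
Proof. by move=> Af; exact: (subalgM (subalg_cst c) Af). Qed.

Lemma subalgB f g : A f -> A g -> A (fun x => f x - g x).
Proof.
move=> Af /(subalgZ (-1)) Ag; apply: subalg_eq (subalgD Af Ag) _ => x.
by rewrite mulN1r.
Qed.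

Lemma subalg_sum (I : Type) (r : seq I) (P : pred I) (F : I -> T -> k) :
  (forall i, P i -> A (F i)) -> A (fun x => \sum_(i <- r | P i) F i x).
Proof.
move=> AF; elim: r => [|i r IHr].
  by apply: subalg_eq (subalg_cst _) _ => x; rewrite big_nil.
case Pi: (P i); last by apply: subalg_eq IHr _ => x; rewrite big_cons Pi.
by apply: subalg_eq (subalgD (AF _ Pi) IHr) _ => x; rewrite big_cons Pi.
Qed.

Lemma subalg_prod (I : Type) (r : seq I) (P : pred I) (F : I -> T -> k) :
  (forall i, P i -> A (F i)) -> A (fun x => \prod_(i <- r | P i) F i x).
Proof.
move=> AF; elim: r => [|i r IHr].
  by apply: subalg_eq (subalg_cst _) _ => x; rewrite big_nil.
case Pi: (P i); last by apply: subalg_eq IHr _ => x; rewrite big_cons Pi.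
by apply: subalg_eq (subalgM (AF _ Pi) IHr) _ => x; rewrite big_cons Pi.
Qed.

Lemma subalgX f n : A f -> A (fun x => f x ^+ n).
Proof.
move=> Af; elim: n => [|n IHn]; first exact: subalg_cst.
by apply: subalg_eq (subalgM Af IHn) _ => x; rewrite exprS.
Qed.

Lemma subalg_det n (F : T -> 'M[k]_n) :
  (forall i j, A (fun x => F x i j)) -> A (fun x => \det (F x)).
Proof.
move=> AF; rewrite /determinant; apply: subalg_sum => s _.
by apply: subalgZ; apply: subalg_prod => i _; exact: AF.
Qed.

Lemma subalg_mulmx m n p (F : T -> 'M[k]_(m, n)) (G : T -> 'M[k]_(n, p)) :
  (forall i j, A (fun x => F x i j)) -> (forall i j, A (fun x => G x i j)) ->
  forall i j, A (fun x => (F x *m G x) i j).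
Proof.
move=> AF AG i j.
have := subalg_sum (index_enum 'I_n) (P := xpredT) (fun l _ => subalgM (AF i l) (AG l j)).
by move/subalg_eq; apply=> x; rewrite mxE.
Qed.

End Subalgebras.

Section AffineNullstellensatz.
Variable k : closedFieldType.

Lemma nullstellensatz_base : nullstellensatz_for (idfun : {rmorphism k -> k}).
Proof.
move=> I v Iid Iv; have [_ _ IM] := Iid.
have I0 a : I a -> a = 0.
  move=> Ia; have [//|a0] := eqVneq a 0; case: (Iv 0).
  by rewrite expr0 -(mulVf a0); exact: IM.
exists idfun; split => //=; apply/eqP => v0; apply: (Iv 1%N).
by rewrite expr1 v0; case: Iid.
Qed.

(** [R] is the polynomial ring in [n] variables, built one variable at a time so that
    [nullstellensatz_poly] applies, and [E t] is evaluation at [t]. *)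
Lemma polynomial_algebra n :
  exists (R : idomainType) (i : {rmorphism k -> R})
         (E : ('I_n -> k) -> {rmorphism R -> k}),
  [/\ nullstellensatz_for i, forall t c, E t (i c) = c,
      forall (T : Type) (g : 'I_n -> T -> k) (A : set (T -> k)), subalgebra A ->
        (forall j, A (g j)) -> forall p, A (fun x => E (g^~ x) p) &
      forall j, exists p, forall t, E t p = t j].
Proof.
elim: n => [|n [R [i [E [NR Ei EA EX]]]]].
  exists k, idfun, (fun=> idfun); split => //; first exact: nullstellensatz_base.
    by move=> T g A Aalg _ p; exact: subalg_cst.
  by case.
pose E' (t : 'I_n.+1 -> k) : {rmorphism {poly R} -> k} :=
  horner_eval (t ord0) \o map_poly (E (fun j => t (lift ord0 j))).
exists {poly R}, (polyC \o i), E'; split.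
- exact: nullstellensatz_poly.
- by move=> t c; rewrite /E' /= map_polyC /= /horner_eval hornerC Ei.
- move=> T g A Aalg Ag p.
  have Ap (j : 'I_(size p)) : A (fun x => E (fun j => g (lift ord0 j) x) p`_j * g ord0 x ^+ j).
    apply: (subalgM Aalg); last exact: (subalgX Aalg).
    exact: (EA _ (fun j => g (lift ord0 j))).
  have := subalg_sum Aalg (index_enum _) (P := xpredT) (fun j _ => Ap j).
  move/subalg_eq; apply=> x.
  rewrite /E' /= /horner_eval (horner_coef_wide _ (size_poly _ _)).
  by apply: eq_bigr => j _; rewrite coef_map.
- move=> j; case: (unliftP ord0 j) => [l|] ->.
    have [p Ep] := EX l; exists p%:P => t.
    by rewrite /E' /= map_polyC /= /horner_eval hornerC Ep.
  by exists 'X => t; rewrite /E' /= map_polyX /horner_eval hornerX.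
Qed.

(** Generators present [reg X] as a quotient of a polynomial ring. The Nullstellensatz for the
    preimage [J] of [I] gives a homomorphism that descends to [reg X], hence a point. *)
Lemma zero_of_proper_ideal (X : funSpace k) (I : set (X -> k)) :
  affine_variety X -> ideal I -> ~ I (fun=> 1) ->
  exists x, forall f, I f -> f x = 0.
Proof.
move=> [Xalg [n [g gX]] Xpt] [IX I0 ID IM] I1.
have [R [i [E [NR Ei EA EX]]]] := polynomial_algebra n.
pose ev p x := E (g^~ x) p.
have Xg j : reg X (g j) by rewrite gX; apply: sub_gen_smallest; exists j.
have Xev p : reg X (ev p) by exact: (EA _ g).
pose J := [set p | I (ev p)].
have Jid : ring_ideal J.
  split; rewrite /J /=.
  - by rewrite (_ : ev 0 = fun=> 0) //; apply/funext => x; rewrite /ev rmorph0.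
  - move=> a b Ia Ib; rewrite (_ : ev (a + b) = ev a \+ ev b); first exact: ID.
    by apply/funext => x; rewrite /ev rmorphD.
  - move=> a b Ib; rewrite (_ : ev (a * b) = ev a \* ev b); first exact: IM.
    by apply/funext => x; rewrite /ev rmorphM.
have J1 m : ~ J (1 ^+ m).
  by rewrite expr1n /J /= (_ : ev 1 = fun=> 1) //; apply/funext => x; rewrite /ev rmorph1.
have [phi [phii phiJ _]] := NR J 1 Jid J1.
have evS f : reg X f -> exists p, f = ev p.
  rewrite gX; move: f; apply: smallest_sub.
    split.
    - by move=> c; exists (i c); apply/funext => x; rewrite /ev Ei.
    - by move=> _ _ [p ->] [q ->]; exists (p + q); apply/funext => x; rewrite /ev rmorphD.
    - by move=> _ _ [p ->] [q ->]; exists (p * q); apply/funext => x; rewrite /ev rmorphM.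
  by move=> _ [j _ <-]; have [p Ep] := EX j; exists p; apply/funext => x; rewrite /ev Ep.
(* [J] contains all relations between the generators, because [I] contains 0. *)
have evI p q : ev p = ev q -> phi p = phi q.
  move=> pq; apply/eqP; rewrite -subr_eq0 -rmorphB; apply/eqP/phiJ.
  rewrite /J /= (_ : ev (p - q) = fun=> 0) //; apply/funext => x.
  by rewrite /ev rmorphB -/(ev p x) -/(ev q x) pq subrr.
pose c (f : reg X) : R := sval (cid (evS _ (set_mem (svalP f)))).
have cE f : val f = ev (c f) by rewrite /c; case: cid.
have Phom : alghom (fun f : reg X => phi (c f)).
  split.
  - move=> d f fd; rewrite -(phii d); apply: evI; rewrite -cE fd.
    by apply/funext => x; rewrite /ev Ei.
  - move=> f h s sE; rewrite -rmorphD; apply: evI; rewrite -cE sE !cE.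
    by apply/funext => x; rewrite /ev rmorphD.
  - move=> f h s sE; rewrite -rmorphM; apply: evI; rewrite -cE sE !cE.
    by apply/funext => x; rewrite /ev rmorphM.
have [x [xP _]] := Xpt _ Phom.
exists x => f If; have := xP (exist _ f (mem_set (IX _ If))); rewrite /= => <-.
by apply: phiJ; rewrite /J /= -cE.
Qed.

End AffineNullstellensatz.

(** * Bases of finite-dimensional spaces of functions *)

Section FunctionBasis.
Variables (k : fieldType) (T : Type).

(** Take as many functions of [U] and points as possible with an invertible evaluation matrix. The
    basis consists of elements of [U] itself, so it can be picked among the translates of one
    function. *)
Lemma function_basis (U : set (T -> k)) (I : finType) (b : I -> T -> k) :
  (forall u, U u -> exists c : I -> k, forall x, u x = \sum_i c i * b i x) ->
  exists d (u : 'I_d -> T -> k) (y : 'I_d -> T),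
    [/\ forall i, U (u i), \matrix_(i, j) u i (y j) \in unitmx &
        forall f, U f -> exists c : 'rV_d, forall x, f x = \sum_i c 0 i * u i x].
Proof.
move=> Ub.
pose Q d := `[< exists (u : 'I_d -> T -> k) (y : 'I_d -> T),
  (forall i, U (u i)) /\ \matrix_(i, j) u i (y j) \in unitmx >].
have Q0 : exists d, Q d.
  have e A : 'I_0 -> A by case.
  exists 0; apply/asboolP; exists (e _), (e _); split; first by case.
  by rewrite unitmxE det_mx00 unitr1.
have Qb d : Q d -> (d <= #|I|)%N.
  move=> /asboolP[u [y [Uu uy]]].
  have [c cE] := choice (fun i => Ub _ (Uu i)).
  have E : \matrix_(i, j) u i (y j) =
      (\matrix_(i < d, l < #|I|) c i (enum_val l)) *m (\matrix_(l < #|I|, j < d) b (enum_val l) (y j)).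
    apply/matrixP => i j; rewrite !mxE cE (reindex _ (onW_bij _ (enum_val_bij I))) /=.
    by apply: eq_bigr => l _; rewrite !mxE.
  rewrite -(mxrank_unit uy) E; apply: leq_trans (mxrankM_maxl _ _) _.
  exact: rank_leq_col.
case: (ex_maxnP Q0 Qb) => d /asboolP[u [y [Uu uy]]] dmax.
exists d, u, y; split => // f Uf.
set W := \matrix_(i, j) u i (y j) in uy.
pose r : 'rV_d := \row_j f (y j).
exists (r *m invmx W) => x; set c := r *m _.
(* The defect at [x] is the Schur complement of [W] in the matrix bordered by [f] and [x]; if it is
   nonzero, that matrix is invertible, against the maximality of [d]. *)
apply/eqP; rewrite -subr_eq0; apply/negPn/negP => nz.
have : Q d.+1.
  apply/asboolP.
  pose u' (i : 'I_(1 + d)) := match split i with inl _ => f | inr l => u l end.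
  pose y' (i : 'I_(1 + d)) := match split i with inl _ => x | inr l => y l end.
  exists u', y'; split.
    by move=> i; rewrite /u'; case: (@split 1 d i).
  have -> : \matrix_(i, j) u' i (y' j) =
      block_mx (f x)%:M r (\col_i u i x) W.
    rewrite -[LHS](@submxK _ 1 d 1 d); congr block_mx; apply/matrixP => i j;
      by rewrite !mxE /u' /y' ?(unsplitK (inl _)) ?(unsplitK (inr _)) ?ord1 ?eqxx ?mulr1n.
  have := @det_mulmx k (1 + d) (block_mx 1 (- c) 0 1%:M) (block_mx (f x)%:M r (\col_i u i x) W).
  rewrite mulmx_block !mul0mx !mul1mx !add0r det_ublock !det1 !mul1r.
  have -> : r + - c *m W = 0 by rewrite mulNmx /c mulmxKV // subrr.
  rewrite det_lblock unitmxE unitfE => <-; rewrite mulf_neq0 //; last by rewrite -unitfE -unitmxE.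
  rewrite det_mx11 !mxE eqxx mulr1n; congr (_ != 0): nz; congr (_ + _).
  by rewrite -sumrN; apply: eq_bigr => i _; rewrite !mxE mulNr.
by move/dmax; rewrite ltnn.
Qed.

End FunctionBasis.

(** * Affine monoids, their representations and their units *)

Section AffineMonoids.
Variables (k : closedFieldType) (M : funSpace k) (mul : M -> M -> M) (one : M).
Hypothesis Mmon : affine_monoid mul one.
Implicit Types (f F : M -> k) (x y z g : M).

Local Notation "x ** y" := (mul x y) (at level 40, left associativity).
Local Notation unit := (unit_group mul one).

Lemma reg_subalg : subalgebra (reg M).
Proof. by have [[]] := Mmon. Qed.

Lemma mon_mulA x y z : x ** (y ** z) = x ** y ** z.
Proof. by have [_ mA _ _ _] := Mmon; exact: mA. Qed.

Lemma mon_mul1 x : one ** x = x.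
Proof. by have [_ _ m1 _ _] := Mmon; exact: m1. Qed.

Lemma mon_1mul x : x ** one = x.
Proof. by have [_ _ _ m1 _] := Mmon; exact: m1. Qed.

Lemma reg_separates x y : (forall f, reg M f -> f x = f y) -> x = y.
Proof.
move=> xy; have [[_ _ pt] _ _ _ _] := Mmon.
have [z [_ zu]] := pt _ (alghom_ev (reg M) x).
rewrite -(zu x) //; apply: zu => f; exact: (xy _ (set_mem (svalP f))).
Qed.

Lemma reg_comult f : reg M f ->
  exists n (a b : 'I_n -> M -> k),
    [/\ forall i, reg M (a i), forall i, reg M (b i) &
        forall x y, f (x ** y) = \sum_i a i x * b i y].
Proof.
have [_ _ _ _ mm] := Mmon; move=> /mm[n [a [b fE]]].
exists n, (fun i => val (a i)), (fun i => val (b i)); split.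
- by move=> i; exact: (set_mem (svalP (a i))).
- by move=> i; exact: (set_mem (svalP (b i))).
- by move=> x y; exact: (fE (x, y)).
Qed.

Lemma reg_mull y f : reg M f -> reg M (fun x => f (y ** x)).
Proof.
move=> /reg_comult[n [a [b [_ rb fE]]]].
have := subalg_sum reg_subalg (index_enum 'I_n) (P := xpredT)
  (fun i _ => subalgZ reg_subalg (a i y) (rb i)).
by move/subalg_eq; apply=> x; rewrite fE.
Qed.

Lemma reg_mulr y f : reg M f -> reg M (fun x => f (x ** y)).
Proof.
move=> /reg_comult[n [a [b [ra _ fE]]]].
have := subalg_sum reg_subalg (index_enum 'I_n) (P := xpredT)
  (fun i _ => subalgZ reg_subalg (b i y) (ra i)).
by move/subalg_eq; apply=> x; rewrite fE; apply: eq_bigr => i _; rewrite mulrC.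
Qed.

Definition matrix_representation d (rho : M -> 'M[k]_d) : Prop :=
  [/\ rho one = 1%:M, forall x y, rho (x ** y) = rho x *m rho y &
      forall i j, reg M (fun x => rho x i j)].

(** By the comultiplication the translates [f (x ** _)] span a finite-dimensional space. [rho] is
    the matrix of translation on a basis of translates; computing it from values at the points [y j]
    shows that its entries are regular. *)
Lemma matrix_representation_exists f : reg M f ->
  exists d (rho : M -> 'M[k]_d) (u : M -> 'cV[k]_d) (c : 'rV[k]_d),
    [/\ matrix_representation rho, forall i, reg M (fun x => u x i 0),
        forall y z, u (y ** z) = rho y *m u z & forall x, f x = (c *m u x) 0 0].
Proof.
move=> rf; have [n [a [b [_ _ fE]]]] := reg_comult rf.
pose U := [set v | exists x, v = fun z => f (x ** z)].
have [|d [u [y [Uu uy Uc]]]] := @function_basis k M U 'I_n b.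
  by move=> v [x ->]; exists (a^~ x) => z; rewrite fE.
have ru i : reg M (u i) by have [x ->] := Uu i; exact: reg_mull.
set W := \matrix_(i, j) u i (y j) in uy.
pose uc x : 'cV_d := \col_i u i x.
pose Um x : 'M_d := \matrix_(i, j) u i (x ** y j).
pose rho x := Um x *m invmx W.
have Um1 : Um one = W by apply/matrixP => i j; rewrite !mxE mon_mul1.
have ucM x z : uc (x ** z) = rho x *m uc z.
  have : forall i, exists c : 'rV_d, forall t, u i (x ** t) = \sum_l c 0 l * u l t.
    by move=> i; have [x0 uE] := Uu i; apply: Uc; exists (x0 ** x); apply/funext => t;
      rewrite uE mon_mulA.
  move=> /choice[c cE]; pose C := \matrix_(i, l) c i 0 l.
  have -> : rho x = C.
    apply: (canLR (mulmxK uy)); apply/matrixP => i j; rewrite !mxE cE.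
    by apply: eq_bigr => l _; rewrite !mxE.
  by apply/colP => i; rewrite !mxE cE; apply: eq_bigr => l _; rewrite !mxE.
have UmM x z : Um (x ** z) = rho x *m Um z.
  apply/matrixP => i j; have /colP/(_ i) := ucM x (z ** y j).
  by rewrite !mxE mon_mulA => ->; apply: eq_bigr => l _; rewrite !mxE.
have [c cE] : exists c : 'rV_d, forall x, f x = \sum_i c 0 i * u i x.
  by apply: Uc; exists one; apply/funext => z; rewrite mon_mul1.
exists d, rho, uc, c; split => //.
- split.
  + by rewrite /rho Um1 mulmxV.
  + by move=> x z; rewrite {1}/rho UmM -mulmxA.
  + apply: (subalg_mulmx reg_subalg) => i j; last exact: (subalg_cst reg_subalg).
    by apply: subalg_eq (reg_mulr (y j) (ru i)) _ => x; rewrite mxE.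
- by move=> i; apply: subalg_eq (ru i) _ => x; rewrite mxE.
- by move=> x; rewrite cE mxE; apply: eq_bigr => i _; rewrite !mxE.
Qed.

(* The functions lying in a finite-dimensional space [span v] that is contained
   in its own image under [f |-> f (x ** _)]; on such a space this translation
   is bijective. *)
Definition translation_solvable x : set (M -> k) := [set f |
  exists (I : finType) (v : I -> M -> k) (N : I -> I -> k) (c : I -> k),
    [/\ forall i, reg M (v i), forall i z, v i z = \sum_j N i j * v j (x ** z) &
        forall z, f z = \sum_i c i * v i z]].

Section LeftTranslation.
Variable x : M.

Lemma translation_solvable_subalg : subalgebra (translation_solvable x).
Proof.
split.
- move=> c; exists 'I_1, (fun _ _ => 1), (fun _ _ => 1), (fun=> c); split.
  + by move=> _; exact: (subalg_cst reg_subalg).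
  + by move=> _ z; rewrite big_ord1 mulr1.
  + by move=> z; rewrite big_ord1 mulr1.
- move=> f h [I [v [N [c [rv vN fE]]]]] [J [w [P [d [rw wP hE]]]]].
  exists (I + J)%type.
  exists (fun s => match s with inl i => v i | inr j => w j end).
  exists (fun s t => match s, t with
    | inl i, inl i' => N i i' | inr j, inr j' => P j j' | _, _ => 0 end).
  exists (fun s => match s with inl i => c i | inr j => d j end); split.
  + by case.
  + case=> i z; rewrite big_sumType /=.
      by rewrite [X in _ + X]big1 ?addr0 // => j _; rewrite mul0r.
    by rewrite [X in X + _]big1 ?add0r // => j _; rewrite mul0r.
  + by move=> z; rewrite big_sumType /= -fE -hE.
- move=> f h [I [v [N [c [rv vN fE]]]]] [J [w [P [d [rw wP hE]]]]].
  exists (I * J)%type, (fun s z => v s.1 z * w s.2 z).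
  exists (fun s t => N s.1 t.1 * P s.2 t.2), (fun s => c s.1 * d s.2); split.
  + by move=> s; exact: (subalgM reg_subalg).
  + move=> [i j] z; rewrite vN wP big_distrlr pair_big /=.
    by apply: eq_bigr => -[i' j'] _; rewrite mulrACA.
  + move=> z; rewrite /= fE hE big_distrlr pair_big /=.
    by apply: eq_bigr => -[i' j'] _; rewrite mulrACA.
Qed.

(** The comorphism [f |-> f (x ** _)] is bijective on [reg M]. Its inverse followed by evaluation at
    [one] is a homomorphism, hence a point [y], and [y] inverts [x]. *)
Lemma translation_unit : (forall f, reg M f -> translation_solvable x f) -> unit x.
Proof.
move=> all.
have surj f : reg M f -> exists F, reg M F /\ forall z, f z = F (x ** z).
  move=> /all[I [v [N [c [rv vN fE]]]]].
  exists (fun z => \sum_i c i * \sum_j N i j * v j z); split.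
    apply: (subalg_sum reg_subalg) => i _; apply: (subalgZ reg_subalg).
    by apply: (subalg_sum reg_subalg) => j _; exact: (subalgZ reg_subalg).
  by move=> z; rewrite fE; apply: eq_bigr => i _; rewrite vN.
have inj F : reg M F -> (forall z, F (x ** z) = 0) -> forall z, F z = 0.
  move=> /all[I [v [N [c [rv vN FE]]]]] Fx.
  pose U := [set w : M -> k | exists c : I -> k, forall z, w z = \sum_i c i * v i z].
  have [//|d [w [y [Uw wy Uc]]]] := @function_basis k M U I v.
  set W := \matrix_(i, j) w i (y j) in wy.
  pose Wx : 'M_d := \matrix_(i, j) w i (x ** y j).
  have : forall i, exists e : 'rV_d, forall z, w i z = \sum_l e 0 l * w l (x ** z).
    move=> i; have [ci wE] := Uw i.
    pose w' z := \sum_i ci i * \sum_j N i j * v j z.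
    have [e w'E] : exists e : 'rV_d, forall z, w' z = \sum_l e 0 l * w l z.
      apply: Uc; exists (fun j => \sum_i ci i * N i j) => z; rewrite /w'.
      under [RHS]eq_bigr do rewrite mulr_suml; rewrite exchange_big /=.
      by apply: eq_bigr => l _; rewrite mulr_sumr; apply: eq_bigr => j _; rewrite mulrA.
    by exists e => z; rewrite -w'E wE /w'; apply: eq_bigr => l _; rewrite vN.
  move=> /choice[e eE].
  (* The [w i] are combinations of their own translates, so the evaluation matrix [Wx] of the
     translates is invertible too and the translates are independent. *)
  have WE : W = (\matrix_(i, l) e i 0 l) *m Wx.
    by apply/matrixP => i j; rewrite !mxE eE; apply: eq_bigr => l _; rewrite !mxE.
  have Wxu : Wx \in unitmx by move: wy; rewrite WE unitmx_mul => /andP[].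
  have [a aE] : exists a : 'rV_d, forall z, F z = \sum_l a 0 l * w l z.
    by apply: Uc; exists c.
  have a0 : a = 0.
    apply: (can_inj (mulmxK Wxu)); apply/rowP => j; rewrite mul0mx !mxE.
    by rewrite -[RHS](Fx (y j)) aE; apply: eq_bigr => l _; rewrite !mxE.
  by move=> z; rewrite aE a0 big1 // => l _; rewrite mxE mul0r.
have injE F F' : reg M F -> reg M F' -> (forall z, F (x ** z) = F' (x ** z)) ->
    forall z, F z = F' z.
  move=> rF rF' FF' z; apply/eqP; rewrite -subr_eq0; apply/eqP.
  apply: (inj (fun z => F z - F' z)); first exact: (subalgB reg_subalg).
  by move=> t; rewrite FF' subrr.
have : forall f : reg M, exists F, reg M F /\ forall z, val f z = F (x ** z).
  by move=> f; apply: surj; exact: (set_mem (svalP f)).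
move=> /choice[Fs FsP].
have hom : alghom (fun f : reg M => Fs f one).
  split.
  - move=> c f fc; apply: (injE _ (fun=> c)) => [|| z]; first by have [] := FsP f.
      exact: (subalg_cst reg_subalg).
    by have [_ <-] := FsP f; rewrite fc.
  - move=> f h s sE; apply: (injE _ (fun z => Fs f z + Fs h z)) => [|| z].
    + by have [] := FsP s.
    + by have [? _] := FsP f; have [? _] := FsP h; exact: (subalgD reg_subalg).
    + by have [_ <-] := FsP s; have [_ <-] := FsP f; have [_ <-] := FsP h; rewrite sE.
  - move=> f h s sE; apply: (injE _ (fun z => Fs f z * Fs h z)) => [|| z].
    + by have [] := FsP s.
    + by have [? _] := FsP f; have [? _] := FsP h; exact: (subalgM reg_subalg).
    + by have [_ <-] := FsP s; have [_ <-] := FsP f; have [_ <-] := FsP h; rewrite sE.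
have [[_ _ pt] _ _ _ _] := Mmon.
have [y [yE _]] := pt _ hom.
have yP F : reg M F -> F one = F (x ** y).
  move=> rF; pose f : reg M := SigSub (mem_set (reg_mull x rF)).
  rewrite -[RHS](yE f); have [rFs FsE] := FsP f.
  by apply: injE => // z; rewrite -FsE.
have xy : x ** y = one by apply: reg_separates => f /yP->.
exists y; split => //; apply: reg_separates => f rf.
have [F [rF fE]] := surj f rf.
by rewrite !fE mon_mulA xy mon_mul1 mon_1mul.
Qed.

End LeftTranslation.

(** For each generator of [reg M], take the determinant of a representation that has it as a matrix
    coefficient. Where the product of these determinants is nonzero, all generators, hence all of
    [reg M], are [translation_solvable]. *)
Lemma unit_character : exists d : M -> k,
  [/\ reg M d, d one = 1, forall x y, d (x ** y) = d x * d y &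
      forall x, unit x <-> d x != 0].
Proof.
have [[_ [n [g gM]] _] _ _ _ _] := Mmon.
have rg j : reg M (g j) by rewrite gM; apply: sub_gen_smallest; exists j.
have : forall j, exists d : M -> k, [/\ reg M d, d one = 1,
    forall x y, d (x ** y) = d x * d y & forall x, d x != 0 -> translation_solvable x (g j)].
  move=> j; have [d [rho [u [c [[rho1 rhoM rrho] ru uM gE]]]]] := matrix_representation_exists (rg j).
  exists (fun x => \det (rho x)); split.
  - exact: (subalg_det reg_subalg).
  - by rewrite rho1 det1.
  - by move=> x y; rewrite rhoM det_mulmx.
  - move=> x; rewrite -unitfE -unitmxE => ux.
    exists 'I_d, (fun i z => u z i 0), (invmx (rho x)), (c 0); split => //.
    + move=> i z; have /(congr1 (mulmx (invmx (rho x)))) := uM x z.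
      by rewrite mulKmx // => /colP/(_ i); rewrite mxE => <-.
    + by move=> z; rewrite gE mxE.
move=> /choice[d dP]; exists (fun x => \prod_j d j x); split.
- by apply: (subalg_prod reg_subalg) => j _; have [] := dP j.
- by rewrite big1 // => j _; have [] := dP j.
- by move=> x y; rewrite -big_split; apply: eq_bigr => j _; have [] := dP j.
move=> x; split => [[y [xy _]]|/prodf_neq0 dx].
  apply/prodf_neq0 => j _; have [_ d1 dM _] := dP j.
  have := oner_neq0 k; rewrite -d1 -xy dM mulf_eq0 negb_or => /andP[]; done.
apply: translation_unit => f; rewrite gM; move: f; apply: smallest_sub.
  exact: translation_solvable_subalg.
by move=> _ [j _ <-]; have [_ _ _] := dP j; apply; exact: dx.
Qed.

Lemma unit_mul x y : unit x -> unit y -> unit (x ** y).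
Proof.
have [d [_ _ dM dU]] := unit_character.
by move=> /dU dx /dU dy; apply/dU; rewrite dM mulf_neq0.
Qed.

End AffineMonoids.

(** * Irreducible components and density of the units *)

Section Components.
Variables (k : closedFieldType) (X : funSpace k).

(** Zorn applies: two points of the union of a chain that escape [Z1] and [Z2] lie in a common
    member of the chain. *)
Lemma irreducible_component_containing (x : X) :
  subalgebra (reg X) -> exists2 Z : set X, irreducible_component Z & Z x.
Proof.
move=> Xalg.
pose Q (Z : set X) := Z = set0 \/ (Z x /\ irreducible Z).
have [F FQ Ftot|Z [QZ Zmax]] := @Zorn_bigcup X Q.
  have [[Y [FY Y0]]|noY] := pselect (exists Y, F Y /\ Y <> set0); last first.
    left; apply/seteqP; split => // y [Y FY Yy]; case: noY; exists Y; split => //.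
    by move=> Y0; rewrite Y0 in Yy.
  have Yx : Y x by case: (FQ _ FY) => [//|[]].
  right; split; first by exists Y.
  split; first by exists x, Y.
  move=> Z1 Z2 c1 c2 sub; apply: contrapT => /not_orP[/existsNP[a /not_implyP[[A FA Aa] Za]]].
  move=> /existsNP[b /not_implyP[[A' FA' A'b] Zb]].
  have key C : F C -> C a -> C b -> False.
    move=> FC Ca Cb; case: (FQ _ FC) => [C0|[_ [_ Cirr]]]; first by rewrite C0 in Ca.
    have [] := Cirr _ _ c1 c2.
    - by move=> t Ct; apply: sub; exists C.
    - by move=> /(_ _ Ca).
    - by move=> /(_ _ Cb).
  have [s|s] := Ftot _ _ FA FA'; first exact: (key _ FA' (s _ Aa) A'b).
  exact: (key _ FA Aa (s _ A'b)).
have irr1 : irreducible [set x].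
  split; first by exists x.
  move=> Z1 Z2 _ _ sub; have [] := sub x erefl; first by left => _ ->.
  by right => _ ->.
case: QZ => [Z0|[Zx Zirr]].
  exfalso; apply: (Zmax [set x]); last by right.
  by rewrite Z0; split => // /(_ x erefl).
exists Z => //; split => // Z' Z'irr ZZ'; apply: contrapT => ne.
apply: (Zmax Z'); last by right; split => //; exact: ZZ'.
by split => // Z'Z; apply: ne; apply/seteqP.
Qed.

Lemma zclosed_zeros (f : X -> k) : reg X f -> zclosed [set x | f x = 0].
Proof.
move=> rf; exists [set f]; first by move=> _ ->.
by apply/seteqP; split => x /= H; [move=> _ ->|exact: H].
Qed.

End Components.

Section UnitDensity.
Variables (k : closedFieldType) (M : funSpace k) (mul : M -> M -> M) (one : M).
Hypothesis Mmon : affine_monoid mul one.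
Hypothesis Mcomp : forall Z : set M, irreducible_component Z ->
  exists g : M, Z g /\ unit_group mul one g.

(** The product of [f] and the unit character [d] vanishes on a component through [x], so one factor
    does; it is not [d], since the component contains a unit. *)
Lemma units_dense f : reg M f -> (forall g, unit_group mul one g -> f g = 0) ->
  forall x, f x = 0.
Proof.
move=> rf fG x.
have [d [rd _ _ dU]] := unit_character Mmon.
have [Z Zc Zx] := irreducible_component_containing x (reg_subalg Mmon).
have [g [Zg /dU dg]] := Mcomp Zc.
have [[_ Zirr] _] := Zc.
have [|sub|sub] := Zirr _ _ (zclosed_zeros rf) (zclosed_zeros rd).
- move=> y _; have [dy|dy] := eqVneq (d y) 0; first by right.
  by left; apply: fG; apply/dU.
- exact: sub.
- by have := sub _ Zg; move=> /= dg0; rewrite dg0 eqxx in dg.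
Qed.

End UnitDensity.

(** * Characters of the monoid with prescribed weights on [H] *)

Lemma subspace_row_space (k : fieldType) n (L : set 'rV[k]_n) :
  L 0 -> (forall v w, L v -> L w -> L (v + w)) -> (forall c v, L v -> L (c *: v)) ->
  exists X : 'M[k]_n, forall v, L v <-> (v <= X)%MS.
Proof.
move=> L0 LD LZ.
pose Q r := `[< exists X : 'M[k]_n, (forall v : 'rV_n, (v <= X)%MS -> L v) /\ \rank X = r >].
have Q0 : exists r, Q r.
  exists 0; apply/asboolP; exists 0; split; last by rewrite mxrank0.
  by move=> v /submx0null->.
have Qn r : Q r -> (r <= n)%N by move=> /asboolP[X [_ <-]]; exact: rank_leq_row.
case: (ex_maxnP Q0 Qn) => r /asboolP[X [XL Xr]] rmax.
exists X => v; split => [Lv|]; last exact: XL.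
apply: contrapT => /negP vX.
have /rmax : Q (\rank (X + v)%MS).
  apply/asboolP; exists (X + v)%MS; split => // w /sub_addsmxP[[a b] /= ->].
  apply: LD; first by apply: XL; exact: submxMl.
  by rewrite [b]mx11_scalar mul_scalar_mx; exact: LZ.
rewrite -Xr leqNgt rank_ltmx // ltmxE addsmxSl /=.
by apply: contra vX; apply: submx_trans; exact: addsmxSr.
Qed.

Section InverseWeight.
Variables (k : closedFieldType) (M : funSpace k) (mul : M -> M -> M) (one : M).
Variable H : set M.
Hypothesis Mmon : affine_monoid mul one.
Hypothesis Mcomp : forall Z : set M, irreducible_component Z ->
  exists g : M, Z g /\ unit_group mul one g.
Hypothesis Hnormal : normal_subgroup mul one H.
Variable q : M -> k.
Hypothesis regq : reg M q.
Hypothesis q1 : q one = 1.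
Hypothesis qM : forall h h', H h -> H h' -> q (mul h h') = q h * q h'.

Local Notation "x ** y" := (mul x y) (at level 40, left associativity).
Local Notation unit := (unit_group mul one).
Local Notation representation := (matrix_representation mul one).

Lemma normal1 : H one. Proof. by case: Hnormal. Qed.

Lemma normal_conj g g' h : g ** g' = one -> g' ** g = one -> H h -> H (g ** h ** g').
Proof. by case: Hnormal => _ _ _ _; apply. Qed.

(* The pairs [(rho a, q a)] for [a] in the group algebra of [H]. *)
Inductive group_algebra_pair n (rho : M -> 'M[k]_n) : 'M[k]_n -> k -> Prop :=
| GapGen h of H h : group_algebra_pair rho (rho h) (q h)
| GapAdd A s B t of group_algebra_pair rho A s & group_algebra_pair rho B t :
    group_algebra_pair rho (A + B) (s + t)
| GapScale c A s of group_algebra_pair rho A s :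
    group_algebra_pair rho (c *: A) (c * s).

(** Equivalently, [q] factors through the image of the group algebra of [H] under [rho]. *)
Definition separates_weight n (rho : M -> 'M[k]_n) : Prop :=
  forall t, group_algebra_pair rho 0 t -> t = 0.

Lemma gap_mul n (rho : M -> 'M[k]_n) A s B t : representation rho ->
  group_algebra_pair rho A s -> group_algebra_pair rho B t ->
  group_algebra_pair rho (A *m B) (s * t).
Proof.
have [_ _ HM _ _] := Hnormal.
move=> [_ rhoM _] As Bt; elim: As => [h Hh|A1 s1 A2 s2 _ IH1 _ IH2|c A1 s1 _ IH1].
- elim: Bt => [h' Hh'|B1 t1 B2 t2 _ IH1 _ IH2|c B1 t1 _ IH1].
  + by rewrite -rhoM -qM //; apply: GapGen; exact: HM.
  + by rewrite mulmxDr mulrDr; exact: GapAdd.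
  + by rewrite -scalemxAr mulrCA; exact: GapScale.
- by rewrite mulmxDl mulrDl; exact: GapAdd.
- by rewrite -scalemxAl -mulrA; exact: GapScale.
Qed.

(** When [q] is a matrix coefficient, the weight is the linear function [c *m A *m u one] of the
    image [A]. *)
Lemma separating_representation :
  exists n (rho : M -> 'M[k]_n), representation rho /\ separates_weight rho.
Proof.
have [n [rho [u [c [rrep _ uM qE]]]]] := matrix_representation_exists Mmon regq.
exists n, rho; split => // t.
have gen A s : group_algebra_pair rho A s -> s = (c *m A *m u one) 0 0.
  elim=> [h Hh|A1 s1 A2 s2 _ -> _ ->|e A1 s1 _ ->].
  - by rewrite qE -mulmxA -uM (mon_1mul Mmon).
  - by rewrite mulmxDr mulmxDl [RHS]mxE.
  - by rewrite -scalemxAr -scalemxAl [RHS]mxE.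
by move=> /gen->; rewrite mulmx0 mul0mx mxE.
Qed.

Section MinimalRepresentation.
Variables (n : nat) (rho : M -> 'M[k]_n).
Hypothesis rho_rep : representation rho.
Hypothesis rho_sep : separates_weight rho.
Hypothesis n_min : forall m (sigma : M -> 'M[k]_m),
  representation sigma -> separates_weight sigma -> (n <= m)%N.

Let rho1 : rho one = 1%:M. Proof. by case: rho_rep. Qed.
Let rhoM x y : rho (x ** y) = rho x *m rho y. Proof. by case: rho_rep. Qed.
Let reg_rho i j : reg M (fun x => rho x i j). Proof. by case: rho_rep. Qed.

Let rhoV g g' : g ** g' = one -> rho g *m rho g' = 1%:M.
Proof. by move=> gg'; rewrite -rhoM gg' rho1. Qed.

Lemma minimal_not_separating m (sigma : M -> 'M[k]_m) : (m < n)%N ->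
  representation sigma -> exists2 t, group_algebra_pair sigma 0 t & t != 0.
Proof.
move=> mn srep; apply: contrapT => no; suff: (n <= m)%N by rewrite leqNgt mn.
apply: (n_min srep) => t st; apply/eqP/negPn/negP => t0.
by apply: no; exists t.
Qed.

(* Otherwise both the subrepresentation and the quotient are too small, and the
   product of the elements of the group algebra which they kill is killed by
   [rho]. *)
Lemma minimal_irreducible (X : 'M[k]_n) :
  (forall g, unit g -> (X *m rho g <= X)%MS) -> X != 0 -> row_full X.
Proof.
move=> XG X0; apply/negPn/negP => Xf.
(* Stability passes from the units to all of [M] by density, so that the subspace and the quotient
   are representations of the monoid. *)
have Xst x : (X *m rho x <= X)%MS.
  rewrite submxE; apply/eqP/matrixP => i j; rewrite [RHS]mxE.
  apply: (units_dense Mmon Mcomp (f := fun x => (X *m rho x *m cokermx X) i j)).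
    have r_subalg := reg_subalg Mmon.
    apply: (subalg_mulmx r_subalg); last by move=> *; exact: (subalg_cst r_subalg).
    apply: (subalg_mulmx r_subalg) => // *; exact: (subalg_cst r_subalg).
  by move=> g /XG; rewrite submxE => /eqP->; rewrite mxE.
set r := \rank X in Xf; set s := \rank (cokermx X).
have rn : (r < n)%N by rewrite ltn_neqAle Xf rank_leq_col.
have r0 : (0 < r)%N by rewrite lt0n mxrank_eq0.
have sn : (s < n)%N by rewrite /s mxrank_coker -/r; lia.
(* The rows of [R] are a basis of the subspace and the columns of [C] are coordinates on the
   quotient; with the one-sided inverses, the induced actions are [R *m rho x *m R'] and
   [C' *m rho x *m C]. *)
pose R := row_base X; pose R' := pinvmx R.
have RR' : R *m R' = 1%:M by apply: mulmxVp; exact: row_base_free.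
pose C := col_base (cokermx X); pose C' := pinvmx C.
have C'C : C' *m C = 1%:M by apply: mulVpmx; exact: col_base_full.
have XC (m : nat) (Y : 'M_(m, n)) : (Y <= X)%MS = (Y *m C == 0).
  rewrite submxE -{1}(mulmx_base (cokermx X)) mulmxA -/C; apply/eqP/eqP => [|->]; last by rewrite mul0mx.
  move/(congr1 (fun Z => Z *m pinvmx (row_base (cokermx X)))).
  by rewrite mul0mx -mulmxA mulmxVp ?row_base_free // mulmx1.
have XR : (R :=: X)%MS by exact: eq_row_base.
have RK (m : nat) (Y : 'M_(m, n)) : (Y <= R)%MS -> Y *m R' *m R = Y.
  exact: mulmxKpV.
clearbody R' R C' C.
have Rst x : R *m rho x = R *m rho x *m R' *m R.
  rewrite RK // (eqmxMr _ XR) (submx_trans (Xst x)) //.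
  by rewrite XR.
have Cst x : rho x *m C = C *m (C' *m rho x *m C).
  apply/eqP; rewrite -subr_eq0; apply/eqP.
  rewrite !mulmxA -mulmxBl -{1}(mul1mx (rho x)) -mulmxBl; apply/eqP; rewrite -XC.
  apply: submx_trans (Xst x); apply: submxMr; rewrite XC mulmxBl mul1mx -mulmxA C'C mulmx1.
  by rewrite subrr.
have [|t1 kt1 t10] := @minimal_not_separating r (fun x => R *m rho x *m R') rn.
  have r_subalg := reg_subalg Mmon.
  split; first by rewrite rho1 mulmx1.
    by move=> x y; rewrite rhoM (mulmxA R) {1}Rst !mulmxA.
  apply: (subalg_mulmx r_subalg); last by move=> *; exact: (subalg_cst r_subalg).
  by apply: (subalg_mulmx r_subalg) => // *; exact: (subalg_cst r_subalg).
have [|t2 kt2 t20] := @minimal_not_separating s (fun x => C' *m rho x *m C) sn.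
  have r_subalg := reg_subalg Mmon.
  split; first by rewrite rho1 mulmx1.
    by move=> x y; rewrite rhoM -(mulmxA C') -(mulmxA (rho x)) {1}(Cst y) (mulmxA _ C) {1}Cst !mulmxA C'C mul1mx.
  apply: (subalg_mulmx r_subalg); last by move=> *; exact: (subalg_cst r_subalg).
  by apply: (subalg_mulmx r_subalg) => // *; exact: (subalg_cst r_subalg).
have lift1 A t : group_algebra_pair (fun x => R *m rho x *m R') A t ->
    exists2 A', group_algebra_pair rho A' t & R *m A' = A *m R.
  elim=> [h Hh|A1 s1 A2 s2 _ [B1 g1 e1] _ [B2 g2 e2]|c A1 s1 _ [B1 g1 e1]].
  - by exists (rho h); [exact: GapGen|rewrite -Rst].
  - by exists (B1 + B2); [exact: GapAdd|rewrite mulmxDr mulmxDl e1 e2].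
  - by exists (c *: B1); [exact: GapScale|rewrite -scalemxAr -scalemxAl e1].
have lift2 A t : group_algebra_pair (fun x => C' *m rho x *m C) A t ->
    exists2 A', group_algebra_pair rho A' t & A' *m C = C *m A.
  elim=> [h Hh|A1 s1 A2 s2 _ [B1 g1 e1] _ [B2 g2 e2]|c A1 s1 _ [B1 g1 e1]].
  - by exists (rho h); [exact: GapGen|rewrite Cst].
  - by exists (B1 + B2); [exact: GapAdd|rewrite mulmxDr mulmxDl e1 e2].
  - by exists (c *: B1); [exact: GapScale|rewrite -scalemxAr -scalemxAl e1].
have [A1 g1 e1] := lift1 _ _ kt1; have [A2 g2 e2] := lift2 _ _ kt2.
(* Vectors are rows: [A2] maps everything into the subspace, which [A1] kills. *)
have : A2 *m A1 = 0.
  have : (A2 <= R)%MS by rewrite XR XC e2 mulmx0.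
  by move=> /submxP[D ->]; rewrite -mulmxA e1 mul0mx mulmx0.
have := gap_mul rho_rep g2 g1 => /[swap] -> /rho_sep/eqP.
by rewrite mulf_eq0 (negPf t10) (negPf t20).
Qed.

Let stable_gap (X : 'M[k]_n) A t : (forall h, H h -> (X *m rho h <= X)%MS) ->
  group_algebra_pair rho A t -> (X *m A <= X)%MS.
Proof.
move=> XH; elim=> [h /XH//|A1 s1 A2 s2 _ IH1 _ IH2|c A1 s1 _ IH1].
  by rewrite mulmxDr addmx_sub.
by rewrite -scalemxAr scalemx_sub.
Qed.

Let stable_translate (X : 'M[k]_n) g g' : g ** g' = one -> g' ** g = one ->
  (forall h, H h -> (X *m rho h <= X)%MS) ->
  forall h, H h -> (X *m rho g *m rho h <= X *m rho g)%MS.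
Proof.
move=> gg' g'g XH h Hh.
have -> : X *m rho g *m rho h = X *m rho (g ** h ** g') *m rho g.
  by rewrite -!mulmxA -!rhoM -!(mon_mulA Mmon) g'g (mon_1mul Mmon).
by apply: submxMr; apply: XH; exact: normal_conj.
Qed.

(** If no nonzero vector has weight [q], every vector in a unit translate of a minimal [H]-stable
    subspace is killed by a group algebra element of nonzero weight. Composing an element of nonzero
    weight and least rank with such an element lowers the rank. *)
Lemma minimal_weight_vector :
  exists2 p : 'rV[k]_n, p != 0 & forall h, H h -> p *m rho h = q h *: p.
Proof.
apply: contrapT => nowt.
have wt0 (p : 'rV[k]_n) : (forall h, H h -> p *m rho h = q h *: p) -> p = 0.
  by move=> pw; apply/eqP/negPn/negP => p0; apply: nowt; exists p.
have gap1 : group_algebra_pair rho 1%:M 1.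
  by rewrite -rho1 -q1; apply: GapGen; exact: normal1.
have I0 : (1%:M : 'M[k]_n) != 0.
  apply/eqP => I0; rewrite I0 in gap1.
  by have /eqP := rho_sep gap1; rewrite oner_eq0.
pose stableH (X : 'M[k]_n) := forall h, H h -> (X *m rho h <= X)%MS.
have [S [SH S0 Smin]] : exists S : 'M[k]_n, [/\ stableH S, S != 0 &
    forall X, stableH X -> X != 0 -> (\rank S <= \rank X)%N].
  pose Q r := `[< exists X : 'M[k]_n, [/\ stableH X, X != 0 & \rank X = r] >].
  have exQ : exists r, Q r.
    exists (\rank (1%:M : 'M[k]_n)); apply/asboolP; exists 1%:M; split => //.
    by move=> h _; exact: submx1.
  case: (ex_minnP exQ) => r /asboolP[S [SH S0 Sr]] rmin.
  exists S; split => // X XH X0; rewrite Sr; apply: rmin; apply/asboolP.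
  by exists X.
have kill g (p : 'rV[k]_n) : unit g -> (p <= S *m rho g)%MS ->
    exists A t, [/\ group_algebra_pair rho A t, p *m A = 0 & t != 0].
  move=> [g' [gg' g'g]] pS; apply: contrapT => nokill.
  have none A t : group_algebra_pair rho A t -> p *m A = 0 -> t = 0.
    move=> At pA; apply/eqP/negPn/negP => t0; apply: nokill; by exists A, t.
  (* The image [X] of [p] under elements of weight 0 misses [p]: from [p = p *m A] the element
     [1 - A], of weight 1, would kill [p]. By minimality [X = 0], which makes [p] a vector of weight
     [q], hence 0. *)
  pose L := [set v : 'rV[k]_n | exists2 A, group_algebra_pair rho A 0 & v = p *m A].
  have [|||X XL] := @subspace_row_space k n L.
  - exists (0 *: 1%:M); first by have := GapScale 0 gap1; rewrite mul0r.
    by rewrite scale0r mulmx0.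
  - move=> _ _ [A A0 ->] [B B0 ->]; exists (A + B); last by rewrite mulmxDr.
    by rewrite -(addr0 0); exact: GapAdd.
  - move=> c _ [A A0 ->]; exists (c *: A); last by rewrite scalemxAr.
    by rewrite -(mulr0 c); exact: GapScale.
  have XH : stableH X.
    move=> h Hh; apply/row_subP => i; rewrite row_mul; apply/XL.
    have [A A0 ->] := (XL (row i X)).2 (row_sub i X).
    exists (A *m rho h); last by rewrite mulmxA.
    by rewrite -(mul0r (q h)); apply: gap_mul => //; exact: GapGen.
  have SgH := stable_translate gg' g'g SH.
  have XS : (X < S *m rho g)%MS.
    rewrite ltmxE; apply/andP; split.
      apply/row_subP => i; have [A A0 ->] := (XL (row i X)).2 (row_sub i X).
      apply: submx_trans (stable_gap SgH A0); exact: submxMr.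
    apply/negP => /(submx_trans pS)/XL[A A0 pA].
    have := none (1%:M + (-1) *: A) (1 + (-1) * 0) (GapAdd gap1 (GapScale (-1) A0)).
    rewrite mulmxDr mulmx1 -scalemxAr scaleN1r -pA subrr mulr0 addr0 => /(_ erefl)/eqP.
    by rewrite oner_eq0.
  have [X0|X0] := eqVneq X 0.
    suff p0 : p = 0.
      by have /eqP := none _ _ gap1 (etrans (congr1 (mulmx^~ 1%:M) p0) (mul0mx _ _)); rewrite oner_eq0.
    apply: wt0 => h Hh; apply/eqP; rewrite -subr_eq0.
    have : L (p *m (rho h + (- q h) *: 1%:M)).
      exists (rho h + (- q h) *: 1%:M) => //.
      have -> : 0 = q h + (- q h) * 1 by rewrite mulr1 subrr.
      exact: GapAdd (GapGen _ Hh) (GapScale _ gap1).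
    by move=> /XL; rewrite X0 submx0 mulmxDr -scalemxAr mulmx1 scaleNr.
  have Xg'0 : X *m rho g' != 0.
    apply: contra_neq X0 => Xg'; rewrite -[X]mulmx1 -(rhoV g'g) mulmxA Xg'.
    by rewrite mul0mx.
  have := Smin _ (stable_translate g'g gg' XH) Xg'0.
  rewrite leqNgt (leq_ltn_trans (mxrankM_maxl _ _)) //.
  exact: leq_trans (rank_ltmx XS) (mxrankM_maxl _ _).
pose Q r := `[< exists A t, [/\ group_algebra_pair rho A t, t != 0 & \rank A = r] >].
have exQ : exists r, Q r.
  by exists (\rank (1%:M : 'M[k]_n)); apply/asboolP; exists 1%:M, 1; rewrite oner_neq0.
case: (ex_minnP exQ) => r /asboolP[A [t [At t0 Ar]]] rmin.
(* This space is stable under units. It is zero, since otherwise irreducibility gives [A = 0],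
   against the nonzero weight [t]. *)
pose L := [set v : 'rV[k]_n | forall g, unit g -> v *m rho g *m A = 0].
have [|||X XL] := @subspace_row_space k n L.
- by move=> g _; rewrite !mul0mx.
- by move=> v w Lv Lw g ug; rewrite !mulmxDl Lv // Lw // addr0.
- by move=> c v Lv g ug; rewrite -!scalemxAl Lv // scaler0.
have X0 : X = 0.
  apply/eqP/negPn/negP => X0.
  have /minimal_irreducible : forall g, unit g -> (X *m rho g <= X)%MS.
    move=> g ug; apply/row_subP => i; rewrite row_mul; apply/XL => g1 ug1.
    rewrite -[_ *m rho g *m _]mulmxA -rhoM.
    by apply: (XL (row i X)).2 (row_sub i X) _ _; exact: (unit_mul Mmon).
  move=> /(_ X0) Xfull.
  suff A0 : A = 0 by move: At; rewrite A0 => /rho_sep/eqP; rewrite (negPf t0).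
  apply/row_matrixP => i; rewrite row0 rowE.
  have := (XL (delta_mx 0 i)).2 (submx_full _ Xfull) one.
  by rewrite rho1 mulmx1; apply; exists one; rewrite (mon_mul1 Mmon).
have [i Si] : exists i, row i S != 0.
  apply/existsP; apply: contraNT S0; rewrite negb_exists => /forallP Sz.
  by apply/eqP/row_matrixP => i; rewrite row0; apply/eqP/negPn/Sz.
have [g [ug gA]] : exists g, unit g /\ row i S *m rho g *m A != 0.
  apply: contrapT => no; move/negP: Si; apply.
  rewrite -submx0 -X0; apply/XL => g ug; apply/eqP/negPn/negP => gA.
  by apply: no; exists g.
have [g' [gg' g'g]] := ug.
have [|A' [t' [At' pA' t'0]]] := kill g (row i S *m rho g *m A) ug.
  apply: submx_trans (stable_gap (stable_translate gg' g'g SH) At).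
  by do 2!apply: submxMr; exact: row_sub.
have : Q (\rank (A *m A')).
  by apply/asboolP; exists (A *m A'), (t * t'); split; [exact: gap_mul|rewrite mulf_neq0|].
move=> /rmin; rewrite -Ar leqNgt => /negP; apply.
(* The vector [row i S *m rho g] lies in the larger kernel only. *)
have : (kermx A < kermx (A *m A'))%MS.
  rewrite ltmxE; apply/andP; split; first by apply/sub_kermxP; rewrite mulmxA mulmx_ker mul0mx.
  apply: contra gA => sub; apply/eqP/sub_kermxP; apply: submx_trans sub.
  by apply/sub_kermxP; rewrite mulmxA.
move=> /rank_ltmx; rewrite !mxrank_ker.
have := rank_leq_row A; have := rank_leq_row (A *m A'); lia.
Qed.

End MinimalRepresentation.

(* [delta] is the determinant of a representation with a basis of translates
   [p rho(g_i)] of a vector [p] of weight [q]. *)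
Lemma conjugate_weights_character :
  exists (delta : M -> k) n (g g' : 'I_n -> M) (i0 : 'I_n),
  [/\ reg M delta /\ delta one = 1, forall x y, delta (x ** y) = delta x * delta y,
      forall i, g i ** g' i = one /\ g' i ** g i = one,
      forall h, H h -> delta h = \prod_i q (g i ** h ** g' i) &
      forall h, H h -> q (g i0 ** h ** g' i0) = q h].
Proof.
pose Q m := `[< exists rho : M -> 'M[k]_m, representation rho /\ separates_weight rho >].
have exQ : exists m, Q m.
  by have [m [rho Hrho]] := separating_representation; exists m; apply/asboolP; exists rho.
case: (ex_minnP exQ) => n /asboolP[rho [rep sep]] nmin.
have n_min m (sigma : M -> 'M[k]_m) : representation sigma -> separates_weight sigma -> (n <= m)%N.
  by move=> srep ssep; apply: nmin; apply/asboolP; exists sigma.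
have [p p0 pw] := minimal_weight_vector rep sep n_min.
have [rho1 rhoM rrho] := rep.
pose U := [set v : 'I_n -> k | exists2 g, unit g & v = fun j => (p *m rho g) 0 j].
have [|d [u [y [Uu uy Uc]]]] := @function_basis k 'I_n U 'I_n (fun i j => (i == j)%:R).
  move=> v _; exists v => j; rewrite (bigD1 j) //= eqxx mulr1 big1 ?addr0 // => i /negPf->.
  by rewrite mulr0.
have : forall i, exists gg : M * M, [/\ gg.1 ** gg.2 = one, gg.2 ** gg.1 = one &
    u i = fun j => (p *m rho gg.1) 0 j].
  by move=> i; have [g [g' [gg' g'g]] ->] := Uu i; exists (g, g').
move=> /choice[gg ggP].
pose P : 'M[k]_(d, n) := \matrix_(i, j) u i j.
have rowP i : row i P = p *m rho (gg i).1.
  by apply/matrixP => a j; rewrite !mxE; have [_ _ ->] := ggP i; rewrite mxE ord1.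
have PU g : unit g -> (p *m rho g <= P)%MS.
  move=> ug; have [|c cE] := Uc (fun j => (p *m rho g) 0 j); first by exists g.
  apply/submxP; exists c; apply/matrixP => a j; rewrite ord1 cE [RHS]mxE.
  by apply: eq_bigr => i _; rewrite [P _ _]mxE.
have u1 : unit one by exists one; rewrite (mon_mul1 Mmon).
have Pfull : row_full P.
  have -> : row_full P = row_full <<P>>%MS by rewrite /row_full genmxE.
  apply: (minimal_irreducible rep sep n_min).
    move=> g ug; rewrite (eqmxMr _ (genmxE P)) genmxE; apply/row_subP => i.
    rewrite row_mul rowP -mulmxA -rhoM; apply: PU; apply: (unit_mul Mmon) => //.
    by have [? ? _] := ggP i; exists (gg i).2.
  apply: contra_neq p0 => P0; have := PU _ u1.
  by rewrite rho1 mulmx1 -(genmxE P) P0 submx0 => /eqP.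
have dn : d = n.
  apply/eqP; rewrite eqn_leq; apply/andP; split; last first.
    by rewrite -(eqP Pfull); exact: rank_leq_row.
  have WE : \matrix_(i, j) u i (y j) = P *m (\matrix_(j < n, l < d) (j == y l)%:R).
    apply/matrixP => i j; rewrite !mxE (bigD1 (y j)) //= !mxE eqxx mulr1 big1 ?addr0 // => l /negPf ly.
    by rewrite !mxE ly mulr0.
  rewrite -(mxrank_unit uy) WE (leq_trans (mxrankM_maxl _ _)) //; exact: rank_leq_col.
clear uy Uc Uu; subst d; rewrite row_full_unit in Pfull.
pose D h : 'rV[k]_n := \row_i q ((gg i).1 ** h ** (gg i).2).
have PD h : H h -> P *m rho h = diag_mx (D h) *m P.
  move=> Hh; apply/row_matrixP => i; have [e1 e2 _] := ggP i.
  have -> : row i (diag_mx (D h) *m P) = D h 0 i *: row i P.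
    by apply/matrixP => a j; rewrite mul_diag_mx !mxE.
  rewrite row_mul rowP mxE.
  have pg : p *m rho ((gg i).1 ** h ** (gg i).2) = q ((gg i).1 ** h ** (gg i).2) *: p.
    by apply: pw; exact: normal_conj.
  rewrite scalemxAl -pg -!mulmxA -!rhoM -!(mon_mulA Mmon) e2 (mon_1mul Mmon) //.
(* Every translate occurring in the expansion of [p] must have the weight [q] of [p]; [i0] is the
   index of one of them. *)
pose c := p *m invmx P; have cP : c *m P = p by exact: mulmxKV.
clearbody c.
have [i0 ci0] : exists i, c 0 i != 0.
  apply/existsP; apply: contraNT p0; rewrite negb_exists => /forallP cz.
  rewrite -cP; have -> : c = 0.
    by apply/matrixP => a i; rewrite ord1 [RHS]mxE; apply/eqP/negPn/cz.
  by rewrite mul0mx.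
exists (fun x => \det (rho x)), n, (fun i => (gg i).1), (fun i => (gg i).2), i0; split.
- by split; [exact: (subalg_det (reg_subalg Mmon))|rewrite rho1 det1].
- by move=> x y'; rewrite rhoM det_mulmx.
- by move=> i; have [] := ggP i.
- move=> h Hh; have /(congr1 determinant) := PD h Hh.
  rewrite !det_mulmx mulrC det_diag => /(mulIf _)->; last by rewrite -unitfE -unitmxE.
  by apply: eq_bigr => i _; rewrite mxE.
- move=> h Hh.
  have : c *m diag_mx (D h) = q h *: c.
    by apply: (can_inj (mulmxK Pfull)); rewrite -mulmxA -PD // mulmxA -scalemxAl cP pw.
  move=> /matrixP/(_ 0 i0); rewrite mul_mx_diag !mxE mulrC.
  exact: mulIf.
Qed.

End InverseWeight.

(** * Separation by invariants *)

Section Ideals.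
Variables (k : closedFieldType) (X : funSpace k).
Hypothesis Xalg : subalgebra (reg X).

Lemma idealZ (I : set (X -> k)) c f : ideal I -> I f -> I (fun x => c * f x).
Proof. by case=> _ _ _ IM; exact/IM/(subalg_cst Xalg). Qed.

Lemma idealB (I : set (X -> k)) f g : ideal I -> I f -> I g -> I (fun x => f x - g x).
Proof.
move=> Iid If /(idealZ (-1) Iid) Ig; have [_ _ ID _] := Iid.
by apply: subalg_eq (ID _ _ If Ig) _ => x; rewrite /= mulN1r.
Qed.

Lemma ideal_det (I : set (X -> k)) n (F : X -> 'M[k]_n) (j : 'I_n) : ideal I ->
  (forall i, I (fun x => F x i j)) -> (forall i l, reg X (fun x => F x i l)) ->
  I (fun x => \det (F x)).
Proof.
move=> [IX I0 ID IM] IF rF.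
have sum (r : seq 'I_n) : I (fun x => \sum_(i <- r) F x i j * cofactor (F x) i j).
  elim: r => [|i r IHr]; first by apply: subalg_eq I0 _ => x; rewrite big_nil.
  have rc : reg X (fun x => cofactor (F x) i j).
    apply: (subalgZ Xalg); apply: (subalg_det Xalg) => a b.
    by apply: subalg_eq (rF (lift i a) (lift j b)) _ => x; rewrite !mxE.
  apply: subalg_eq (ID _ _ (IM _ _ rc (IF i)) IHr) _ => x.
  by rewrite /= big_cons mulrC.
by apply: subalg_eq (sum (index_enum 'I_n)) _ => x; rewrite -expand_det_col.
Qed.

(** The sum of [I] and the ideal of [Z] has no common zero, so it contains 1. *)
Lemma ideal_one_on_closed (I : set (X -> k)) (Z : set X) :
  affine_variety X -> ideal I -> zclosed Z ->
  (forall x, Z x -> exists2 f, I f & f x != 0) ->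
  exists2 f, I f & forall x, Z x -> f x = 1.
Proof.
move=> Xaff Iid [S SX ZE] IZ; have [IX I0 ID IM] := Iid.
pose J := [set u : X -> k | exists f s, [/\ I f, reg X s, forall x, Z x -> s x = 0 &
  forall x, u x = f x + s x]].
have Jid : ideal J.
  split.
  - move=> u [f [s [If rs _ uE]]].
    by apply: subalg_eq (subalgD Xalg (IX _ If) rs) _ => x; rewrite uE.
  - exists (fun=> 0), (fun=> 0); split => //; first exact: (subalg_cst Xalg).
    by move=> x; rewrite addr0.
  - move=> u v [f [s [If rs s0 uE]]] [g [t [Ig rt t0 vE]]].
    exists (f \+ g), (s \+ t); split; first exact: ID.
    + exact: (subalgD Xalg).
    + by move=> x Zx /=; rewrite s0 // t0 // addr0.
    + by move=> x /=; rewrite uE vE addrACA.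
  - move=> a u ra [f [s [If rs s0 uE]]].
    exists (a \* f), (a \* s); split; first exact: IM.
    + exact: (subalgM Xalg).
    + by move=> x Zx /=; rewrite s0 // mulr0.
    + by move=> x /=; rewrite uE mulrDr.
have [f [s [If rs s0 E]]] : J (fun=> 1).
  apply: contrapT => /(zero_of_proper_ideal Xaff Jid)[x xJ].
  have Zx : Z x.
    rewrite ZE => g Sg; apply: xJ; exists (fun=> 0), g; split => //; first exact: SX.
      by move=> y; rewrite ZE => /(_ _ Sg).
    by move=> y; rewrite add0r.
  have [f If /eqP] := IZ _ Zx; apply; apply: xJ.
  exists f, (fun=> 0); split => //; first exact: (subalg_cst Xalg).
  by move=> y; rewrite addr0.
by exists f => // x Zx; rewrite (E x) s0 // addr0.
Qed.

Lemma inverse_on_closed (D : X -> k) (Z : set X) : affine_variety X -> reg X D ->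
  zclosed Z -> (forall x, Z x -> D x != 0) ->
  exists2 q, reg X q & forall x, Z x -> q x * D x = 1.
Proof.
move=> Xaff rD Zc DZ.
have [||_ [q rq ->] qD] := @ideal_one_on_closed [set f | exists2 a, reg X a & f = a \* D] Z Xaff _ Zc.
- split.
  + by move=> _ [a ra ->]; exact: (subalgM Xalg).
  + exists (fun=> 0); first exact: (subalg_cst Xalg).
    by apply/funext => x /=; rewrite mul0r.
  + move=> _ _ [a ra ->] [b rb ->]; exists (a \+ b); first exact: (subalgD Xalg).
    by apply/funext => x /=; rewrite mulrDl.
  + move=> a _ ra [b rb ->]; exists (a \* b); first exact: (subalgM Xalg).
    by apply/funext => x /=; rewrite mulrA.
- move=> x Zx; exists D; last exact: DZ.
  exists (fun=> 1); first exact: (subalg_cst Xalg).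
  by apply/funext => y /=; rewrite mul1r.
- by exists q.
Qed.

End Ideals.

Section Observability.
Variables (k : closedFieldType) (M : funSpace k) (mul : M -> M -> M) (one : M).
Variable H : set M.
Hypothesis Mmon : affine_monoid mul one.
Hypothesis Mcomp : forall Z : set M, irreducible_component Z ->
  exists g : M, Z g /\ unit_group mul one g.
Hypothesis Hnormal : normal_subgroup mul one H.
Hypothesis Hclosed : zclosed H.

Local Notation "x ** y" := (mul x y) (at level 40, left associativity).
Local Notation unit := (unit_group mul one).
Local Notation A := (invariants mul H).

Let Malg : subalgebra (reg M) := reg_subalg Mmon.
Let Maff : affine_variety M. Proof. by case: Mmon. Qed.
Let H1 : H one := normal1 Hnormal.
Let HM h h' : H h -> H h' -> H (h ** h').
Proof. by case: Hnormal => _ _ HM _ _; exact: HM. Qed.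
Let HV h : H h -> exists2 h', H h' & h ** h' = one /\ h' ** h = one.
Proof.
case: Hnormal => HU _ _ HV _ Hh; have [h' [hh' h'h]] := HU _ Hh.
by exists h' => //; exact: HV hh' h'h.
Qed.

(* Two semi-invariants [D], [D'] of the same weight [D' h / D' one], only the
   first of which lies in [I].  With [f] in [I] equal to [1] on [H], they are
   the determinants attached to [H]-stable spaces [k f + W] and [W], where [W]
   is spanned by the differences [f (h ** _) - f]. *)
Lemma semiinvariants (I : set (M -> k)) : ideal I -> stable mul H I ->
  (exists2 f, I f & f one != 0) ->
  exists D D' : M -> k, [/\ I D, reg M D', D one != 0, D' one != 0 &
    forall h, H h -> exists c, forall x, D (h ** x) = c * D x /\ D' (h ** x) = c * D' x].
Proof.
move=> Iid Ist [f0 If0 f01]; have [IX I0 ID IM] := Iid.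
(* [I] has no zero on [H]: the translate of [f0] by the inverse of [h] takes the value [f0 one] at
   [h]. *)
have [|f If fH] := ideal_one_on_closed Malg Maff Iid Hclosed.
  move=> h /HV[h' Hh' [_ h'h]]; exists (f0 \o mul h'); first exact: Ist.
  by rewrite /= h'h.
have rf := IX _ If.
pose U := [set v | exists2 h, H h & v = fun x => f (h ** x) - f x].
have [n [a [b [ra rb fE]]]] := reg_comult Mmon rf.
have [|d [u [y [Uu uy Uc]]]] := @function_basis k M U 'I_n b.
  move=> _ [h Hh ->]; exists (fun i => a i h - a i one) => x.
  rewrite fE -{2}(mon_mul1 Mmon x) fE -sumrB.
  by apply: eq_bigr => i _; rewrite mulrBl.
have Iu i : I (u i).
  by have [h Hh ->] := Uu i; apply: (idealB Malg) => //; exact: Ist.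
have ru i := IX _ (Iu i).
set W := \matrix_(i, j) u i (y j) in uy.
pose Um x : 'M_d := \matrix_(i, j) u i (x ** y j).
(* The functions [f] and [u i] are evaluated at [x] and at the [x ** y j]. The first column lies in
   [I], and at [x = one] it is zero below [f], because [f] is 1 on [H]. *)
pose Fm x : 'M_(1 + d) :=
  block_mx (f x)%:M (\row_j f (x ** y j)) (\col_i u i x) (Um x).
have Um1 : Um one = W by apply/matrixP => i j; rewrite !mxE (mon_mul1 Mmon).
have u1 : \col_i u i one = 0 :> 'cV_d.
  apply/colP => i; rewrite !mxE; have [h Hh ->] := Uu i.
  by rewrite (mon_1mul Mmon) !fH // subrr.
have detW : \det W != 0 by rewrite -unitfE -unitmxE.
exists (fun x => \det (Fm x)), (fun x => \det (Um x)); split.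
- apply: (@ideal_det _ _ Malg I (1 + d) Fm (lshift d ord0)) => // [i|i j].
    case: (split_ordP i) => l ->.
      by apply: subalg_eq If _ => x; rewrite block_mxEul ord1 mxE.
    by apply: subalg_eq (Iu l) _ => x; rewrite block_mxEdl mxE.
  case: (split_ordP i) => l ->; case: (split_ordP j) => l' ->.
  + by apply: subalg_eq rf _ => x; rewrite block_mxEul !ord1 mxE.
  + by apply: subalg_eq (reg_mulr Mmon (y l') rf) _ => x; rewrite block_mxEur mxE.
  + by apply: subalg_eq (ru l) _ => x; rewrite block_mxEdl mxE.
  + by apply: subalg_eq (reg_mulr Mmon (y l') (ru l)) _ => x; rewrite block_mxEdr mxE.
- apply: (subalg_det Malg) => i j.
  by apply: subalg_eq (reg_mulr Mmon (y j) (ru i)) _ => x; rewrite mxE.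
- by rewrite /Fm u1 Um1 det_ublock det_scalar1 fH // mul1r.
- by rewrite Um1.
move=> h Hh.
have [c cE] : exists c : 'rV_d, forall x, f (h ** x) - f x = \sum_i c 0 i * u i x.
  by apply: Uc; exists h.
have : forall i, exists e : 'rV_d, forall x, u i (h ** x) = \sum_l e 0 l * u l x.
  move=> i; have [hi Hhi uE] := Uu i.
  have [|e eE] := Uc (fun x => f (hi ** h ** x) - f x); first by exists (hi ** h); first exact: HM.
  exists (e - c) => x; rewrite uE (mon_mulA Mmon).
  have -> : f (hi ** h ** x) - f (h ** x) =
      (f (hi ** h ** x) - f x) - (f (h ** x) - f x) by ring.
  by rewrite eE cE -sumrB; apply: eq_bigr => l _; rewrite !mxE mulrBl.
move=> /choice[e eE]; pose R := \matrix_(i, l) e i 0 l.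
have UmR x : Um (h ** x) = R *m Um x.
  apply/matrixP => i j; rewrite !mxE -(mon_mulA Mmon) eE.
  by apply: eq_bigr => l _; rewrite !mxE.
(* Modulo [W] the function [f] is fixed by [h], so translation on [k f + W] has the same determinant
   as its restriction [R] to [W]. *)
have FmR x : Fm (h ** x) = block_mx 1%:M c 0 R *m Fm x.
  rewrite mulmx_block !mul0mx !mul1mx !add0r -UmR /Fm; congr block_mx.
  - apply/matrixP => i j; rewrite !ord1 !mxE eqxx !mulr1n.
    have -> : f (h ** x) = f x + (f (h ** x) - f x) by ring.
    by rewrite cE; congr (_ + _); apply: eq_bigr => l _; rewrite !mxE.
  - apply/matrixP => i j; rewrite !ord1 !mxE -(mon_mulA Mmon).
    rewrite -[LHS](subrK (f (x ** y j))) cE addrC; congr (_ + _).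
    by apply: eq_bigr => l _; rewrite !mxE.
  - apply/matrixP => i j; rewrite !mxE eE.
    by apply: eq_bigr => l _; rewrite !mxE.
exists (\det R) => x; split; last by rewrite UmR det_mulmx.
by rewrite FmR det_mulmx det_ublock det1 mul1r.
Qed.

(** With [chi h = D' h / D' one], the weight of [delta] is a product of conjugates of [1 / chi].
    Conjugates of [D'] cancel every factor except that of [i0], which is [1 / chi] itself and
    cancels the weight of [D]. *)
Lemma observable_at_one (I : set (M -> k)) : ideal I -> stable mul H I ->
  (exists2 f, I f & f one != 0) -> exists2 f, (I `&` A) f & f one != 0.
Proof.
move=> Iid Ist I1; have [IX I0 ID IM] := Iid.
have [D [D' [ID0 rD' D1 D'1 DH]]] := semiinvariants Iid Ist I1.
have D'w h x : H h -> D' (h ** x) = D' h / D' one * D' x.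
  move=> /DH[c cE]; have [_ ->] := cE x; have [_] := cE one.
  by rewrite (mon_1mul Mmon) => ->; rewrite mulfK.
have Dw h x : H h -> D (h ** x) = D' h / D' one * D x.
  move=> /DH[c cE]; have [-> _] := cE x; have [_] := cE one.
  by rewrite (mon_1mul Mmon) => ->; rewrite mulfK.
have D'H h : H h -> D' h != 0.
  move=> Hh; have [h' Hh' [hh' _]] := HV Hh.
  by apply: contra_neq D'1 => D'h; rewrite -hh' D'w // D'h !mul0r.
(* Closedness of [H] in [M] makes the inverse of [D'] on [H] the restriction of a function on all of
   [M]. *)
have [q0 rq0 q0D] := inverse_on_closed Malg Maff rD' Hclosed D'H.
pose q x := D' one * q0 x.
have qE h : H h -> q h = D' one / D' h.
  move=> Hh; rewrite /q; congr (_ * _); apply: (mulIf (D'H _ Hh)).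
  by rewrite q0D // mulVf // D'H.
have rq : reg M q by exact: (subalgZ Malg).
clearbody q.
have q1 : q one = 1 by rewrite qE // divff.
have qM h h' : H h -> H h' -> q (h ** h') = q h * q h'.
  move=> Hh Hh'; rewrite !qE //; last exact: HM.
  by rewrite D'w //; field; rewrite D'1 !D'H.
have [delta [n [g [g' [i0 [[rdelta delta1] deltaM gV deltaE qi0]]]]]] :=
  conjugate_weights_character Mmon Mcomp Hnormal rq q1 qM.
pose P x := delta x * \prod_(i | i != i0) D' (g i ** x ** g' i).
exists (P \* D).
  split.
    apply: IM => //; apply: (subalgM Malg) => //; apply: (subalg_prod Malg) => i _.
    exact: (reg_mull Mmon (g i) (reg_mulr Mmon (g' i) rD')).
  split; first by apply: IX; apply: IM => //; apply: (subalgM Malg) => //;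
    apply: (subalg_prod Malg) => i _; exact: (reg_mull Mmon (g i) (reg_mulr Mmon (g' i) rD')).
  move=> h Hh; apply/funext => x; rewrite /= /P deltaM Dw // deltaE //.
  rewrite (bigD1 i0) //= qi0 // qE //.
  have E i : D' (g i ** (h ** x) ** g' i) =
      D' (g i ** h ** g' i) / D' one * D' (g i ** x ** g' i).
    have [e1 e2] := gV i.
    rewrite -D'w; last exact: (normal_conj Hnormal).
    congr D'; rewrite !(mon_mulA Mmon); congr (_ ** _ ** _).
    by rewrite -(mon_mulA Mmon (g i ** h)) e2 (mon_1mul Mmon).
  under [X in _ * X * _]eq_bigr do rewrite E.
  rewrite big_split /=.
  have -> : \prod_(i < n | i != i0) q (g i ** h ** g' i) =
      (\prod_(i < n | i != i0) (D' (g i ** h ** g' i) / D' one))^-1.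
    rewrite -prodfV; apply: eq_bigr => i _; rewrite invf_div qE //.
    by have [e1 e2] := gV i; exact: (normal_conj Hnormal).
  have nz : \prod_(i < n | i != i0) (D' (g i ** h ** g' i) / D' one) != 0.
    apply/prodf_neq0 => i _; rewrite mulf_neq0 ?invr_neq0 ?D'H //.
    by have [e1 e2] := gV i; exact: (normal_conj Hnormal).
  by field; rewrite D'1 nz D'H.
rewrite /= /P delta1 mul1r mulf_neq0 //; apply/prodf_neq0 => i _.
by have [e1 _] := gV i; rewrite (mon_1mul Mmon) e1.
Qed.

(** Right translation commutes with the left action of [H] and reduces the unit [x] to [one]. *)
Lemma observable_at (I : set (M -> k)) x : ideal I -> stable mul H I -> unit x ->
  (exists2 f, I f & f x != 0) -> exists2 f, (I `&` A) f & f x != 0.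
Proof.
move=> [IX I0 ID IM] Ist [x' [xx' x'x]] [f If fx].
pose I' := [set F : M -> k | reg M F /\ I (fun y => F (y ** x'))].
have [|||F [[rF IF] [_ FH]] F1] := @observable_at_one I'.
- split.
  + by move=> F [].
  + by split => //; exact: (subalg_cst Malg).
  + by move=> F G [rF IF] [rG IG]; split; [exact: (subalgD Malg)|exact: ID].
  + move=> F G rF [rG IG]; split; first exact: (subalgM Malg).
    by apply: IM => //; exact: (reg_mulr Mmon x' rF).
- move=> h F Hh [rF IF]; split; first exact: (reg_mull Mmon).
  by apply: subalg_eq (Ist _ _ Hh IF) _ => y; rewrite /= (mon_mulA Mmon).
- exists (fun y => f (y ** x)); last by rewrite (mon_mul1 Mmon).
  split; first exact: (reg_mulr Mmon x (IX _ If)).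
  by apply: subalg_eq If _ => y; rewrite -(mon_mulA Mmon) x'x (mon_1mul Mmon).
exists (fun y => F (y ** x')); last by rewrite xx'.
split => //; split; first exact: IX.
move=> h Hh; apply/funext => y /=; rewrite -(mon_mulA Mmon).
by rewrite -[in RHS](FH h Hh).
Qed.

Lemma normal_observable : observable mul H.
Proof.
move=> I Iid Ist [f If f0]; have [IX _ _ _] := Iid.
have [g [ug fg]] : exists g, unit g /\ f g != 0.
  apply: contrapT => no; apply: f0; apply/funext => x.
  apply: (units_dense Mmon Mcomp (IX _ If)) => g ug; apply/eqP/negPn/negP => fg.
  by apply: no; exists g.
have [|F IF Fg] := observable_at Iid Ist ug; first by exists f.
by exists F => // F0; rewrite F0 eqxx in Fg.
Qed.

Lemma invariant_unit_character : exists e : M -> k,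
  [/\ A e, e one = 1, forall x y, e (x ** y) = e x * e y &
      forall x, unit x <-> e x != 0].
Proof.
have [d [rd d1 dM dU]] := unit_character Mmon.
have HU h : H h -> unit h by case: Hnormal => HU _ _ _ _; exact: HU.
have [|q rq qd] := inverse_on_closed Malg Maff rd Hclosed.
  by move=> h /HU/dU.
have qE h : H h -> q h = (d h)^-1.
  by move=> Hh; apply: (mulIf ((dU h).1 (HU _ Hh))); rewrite qd // mulVf //; apply/dU/HU.
have [||delta [n [g [g' [i0 [[rdelta delta1] deltaM gV deltaE _]]]]]] :=
  conjugate_weights_character Mmon Mcomp Hnormal rq.
- by rewrite qE // d1 invr1.
- by move=> h h' Hh Hh'; rewrite !qE //; [rewrite dM invfM|exact: HM].
(* Conjugation by units does not change the character [d], so all [n] factors of the weight of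
   [delta] equal the inverse of [d]. *)
pose e x := d x ^+ n * delta x.
have eM x y : e (x ** y) = e x * e y by rewrite /e dM deltaM exprMn mulrACA.
have e1 : e one = 1 by rewrite /e d1 delta1 expr1n mulr1.
have eU x : unit x <-> e x != 0.
  split => [[y [xy _]]|].
    by have := oner_neq0 k; rewrite -e1 -xy eM mulf_eq0 negb_or => /andP[].
  (* The exponent [n] is positive because the index [i0] exists; otherwise [d x] would not be
     constrained. *)
  rewrite mulf_eq0 negb_or expf_eq0 negb_and => /andP[/orP[n0|dx] _]; last exact/dU.
  by rewrite (leq_ltn_trans (leq0n i0) (ltn_ord i0)) in n0.
exists e; split => //; split.
  by apply: (subalgM Malg) => //; exact: (subalgX Malg).
move=> h Hh; apply/funext => x; rewrite /= eM.
suff -> : e h = 1 by rewrite mul1r.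
rewrite /e deltaE //.
have dg i : q (g i ** h ** g' i) = (d h)^-1.
  have [gg' g'g] := gV i.
  rewrite qE; last exact: (normal_conj Hnormal).
  by rewrite !dM mulrAC -dM gg' d1 mul1r.
under eq_bigr do rewrite dg.
rewrite prodr_const card_ord exprVn divff // expf_neq0 //; exact/dU/HU.
Qed.

End Observability.

(** * Spectra of function algebras *)

Section Spectrum.
Variables (k : closedFieldType) (T : Type) (A : set (T -> k)).
Implicit Types (phi psi : spec A) (f g : T -> k).

(* Evaluation extended by [0] to functions outside [A], so that membership
   proofs do not occur in the terms. *)
Definition spec_val phi f : k :=
  if pselect (A f) is left Af then sval phi (SigSub (mem_set Af)) else 0.

Lemma spec_valE phi (f : A) : spec_val phi (val f) = sval phi f.
Proof.
rewrite /spec_val; case: pselect => [Af|]; last by move=> nA; case: nA; exact: (set_mem (svalP f)).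
by congr (sval phi _); exact: val_inj.
Qed.

Lemma spec_val_sub phi f (Af : A f) : spec_val phi f = sval phi (SigSub (mem_set Af)).
Proof. by rewrite -spec_valE. Qed.

Lemma spec_eq phi psi : (forall f, A f -> spec_val phi f = spec_val psi f) -> phi = psi.
Proof.
move=> E; have pq : sval phi = sval psi.
  by apply/funext => f; rewrite -!spec_valE; exact: (E _ (set_mem (svalP f))).
case: phi psi pq {E} => [p hp] [q hq] /= pq; subst q.
by congr exist; exact: Prop_irrelevance.
Qed.

Lemma spec_val_ev x f : A f -> spec_val (spec_ev A x) f = f x.
Proof. by move=> Af; rewrite spec_val_sub. Qed.

Hypothesis Aalg : subalgebra A.

Lemma spec_val_cst phi c : spec_val phi (fun=> c) = c.
Proof.
rewrite (spec_val_sub _ (subalg_cst Aalg c)).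
by have [pc _ _] := svalP phi; exact: pc.
Qed.

Lemma spec_valD phi f g : A f -> A g ->
  spec_val phi (fun x => f x + g x) = spec_val phi f + spec_val phi g.
Proof.
move=> Af Ag; rewrite !(spec_val_sub _ Af, spec_val_sub _ Ag, spec_val_sub _ (subalgD Aalg Af Ag)).
by have [_ pD _] := svalP phi; exact: pD.
Qed.

Lemma spec_valM phi f g : A f -> A g ->
  spec_val phi (fun x => f x * g x) = spec_val phi f * spec_val phi g.
Proof.
move=> Af Ag; rewrite !(spec_val_sub _ Af, spec_val_sub _ Ag, spec_val_sub _ (subalgM Aalg Af Ag)).
by have [_ _ pM] := svalP phi; exact: pM.
Qed.

Lemma spec_valZ phi c f : A f -> spec_val phi (fun x => c * f x) = c * spec_val phi f.
Proof. by move=> Af; rewrite spec_valM ?spec_val_cst //; exact: subalg_cst. Qed.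

Lemma spec_val_sum phi (I : Type) (r : seq I) (F : I -> T -> k) : (forall i, A (F i)) ->
  spec_val phi (fun x => \sum_(i <- r) F i x) = \sum_(i <- r) spec_val phi (F i).
Proof.
move=> AF; elim: r => [|i r IHr].
  rewrite big_nil -[RHS](spec_val_cst phi); congr spec_val.
  by apply/funext => x; rewrite big_nil.
rewrite big_cons -IHr -spec_valD //; last by apply: subalg_sum => // j _.
by congr spec_val; apply/funext => x; rewrite big_cons.
Qed.

Lemma spec_point (Phi : (T -> k) -> k) : (forall c, Phi (fun=> c) = c) ->
  (forall f g, A f -> A g -> Phi (fun x => f x + g x) = Phi f + Phi g) ->
  (forall f g, A f -> A g -> Phi (fun x => f x * g x) = Phi f * Phi g) ->
  exists phi, forall f, A f -> spec_val phi f = Phi f.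
Proof.
move=> Pc PD PM.
have Av (f : A) : A (val f) := set_mem (svalP f).
have hom : alghom (fun f : A => Phi (val f)).
  split.
  - by move=> c f ->; exact: Pc.
  - by move=> f g s ->; exact: PD.
  - by move=> f g s ->; exact: PM.
by exists (exist _ _ hom) => f Af; rewrite spec_val_sub.
Qed.

Lemma reg_spec f : A f -> reg (spec A) (fun phi => spec_val phi f).
Proof.
by move=> Af; exists (SigSub (mem_set Af)) => //; apply/funext => phi; rewrite -spec_valE.
Qed.

Lemma reg_specP F : reg (spec A) F -> exists2 f, A f & F = fun phi => spec_val phi f.
Proof.
move=> [f _ <-]; exists (val f); first exact: (set_mem (svalP f)).
by apply/funext => phi; rewrite spec_valE.
Qed.

(** Evaluation identifies [A] with [reg (spec A)], so a homomorphism on the latter is one on [A],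
    that is, a point. *)
Lemma spec_affine : finitely_generated A -> affine_variety (spec A).
Proof.
move=> [n [g gA]].
have ralg : subalgebra (reg (spec A)).
  split.
  - move=> c; rewrite (_ : (fun=> c) = fun phi => spec_val phi (fun=> c)).
      exact: reg_spec (subalg_cst Aalg c).
    by apply/funext => phi; rewrite spec_val_cst.
  - move=> _ _ /reg_specP[f Af ->] /reg_specP[h Ah ->].
    rewrite (_ : _ \+ _ = fun phi => spec_val phi (fun x => f x + h x)).
      exact: reg_spec (subalgD Aalg Af Ah).
    by apply/funext => phi; rewrite spec_valD.
  - move=> _ _ /reg_specP[f Af ->] /reg_specP[h Ah ->].
    rewrite (_ : _ \* _ = fun phi => spec_val phi (fun x => f x * h x)).
      exact: reg_spec (subalgM Aalg Af Ah).
    by apply/funext => phi; rewrite spec_valM.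
have Ag j : A (g j) by rewrite gA; apply: sub_gen_smallest; exists j.
split => //.
  exists n, (fun j phi => spec_val phi (g j)); apply/seteqP; split; last first.
    by apply: smallest_sub => // _ [j _ <-]; exact: reg_spec.
  move=> _ /reg_specP[f Af ->] S [[Sc SD SM] gS].
  suff [] : [set f | A f /\ S (fun phi => spec_val phi f)] f by [].
  move: {Af} (Af : A f); rewrite {1}gA; move: f; apply: smallest_sub.
    split.
    - move=> c; split; first exact: subalg_cst.
      by rewrite (_ : (fun phi => _) = fun=> c) //; apply/funext => phi; rewrite spec_val_cst.
    - move=> f h [Af Sf] [Ah Sh]; split; first exact: subalgD.
      by apply: subalg_eq (SD _ _ Sf Sh) _ => phi /=; rewrite -spec_valD.
    - move=> f h [Af Sf] [Ah Sh]; split; first exact: subalgM.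
      by apply: subalg_eq (SM _ _ Sf Sh) _ => phi /=; rewrite -spec_valM.
  by move=> _ [j _ <-]; split => //; apply: gS; exists j.
move=> Psi [Pc PD PM].
pose ev f (Af : A f) : reg (spec A) := SigSub (mem_set (reg_spec Af)).
have evE f (Af : A f) phi : val (ev f Af) phi = spec_val phi f by [].
pose Phi f := if pselect (A f) is left Af then Psi (ev f Af) else 0.
have PhiE f (Af : A f) : Phi f = Psi (ev f Af).
  rewrite /Phi; case: pselect => // Af'; congr Psi; exact: val_inj.
have [|||phi phiE] := @spec_point Phi.
- move=> c; rewrite (PhiE _ (subalg_cst Aalg c)); apply: Pc.
  by apply/funext => phi; rewrite evE spec_val_cst.
- move=> f h Af Ah; rewrite (PhiE _ (subalgD Aalg Af Ah)) (PhiE _ Af) (PhiE _ Ah).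
  by apply: PD; apply/funext => phi; rewrite evE spec_valD.
- move=> f h Af Ah; rewrite (PhiE _ (subalgM Aalg Af Ah)) (PhiE _ Af) (PhiE _ Ah).
  by apply: PM; apply/funext => phi; rewrite evE spec_valM.
have PsiE (F : reg (spec A)) phi' : (forall f, A f -> spec_val phi' f = Phi f) ->
    Psi F = val F phi'.
  move=> phi'E; have [f Af FE] := reg_specP (set_mem (svalP F)).
  have -> : F = ev f Af by apply: val_inj; rewrite /= FE.
  by rewrite evE phi'E // (PhiE _ Af).
exists phi; split; first by move=> F; exact: PsiE.
move=> phi' phi'E; apply: spec_eq => f Af.
by rewrite phiE // (PhiE _ Af) phi'E evE.
Qed.

End Spectrum.

(* An [A]-linear form on [A + sum_i A w_i] that does not vanish at [1], given by
   its values [a] at [1] and [L i] at [w i]. *)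
Lemma nonzero_linear_form_ord (k : fieldType) (T : Type) (A : set (T -> k)) (x0 : T)
    n (w : 'I_n -> T -> k) :
  (forall c, A (fun=> c)) -> (forall f g, A f -> A g -> A (fun x => f x + g x)) ->
  (forall f g, A f -> A g -> A (fun x => f x * g x)) ->
  exists (a : T -> k) (L : 'I_n -> T -> k),
    [/\ A a, exists x, a x != 0, forall i, A (L i) &
      forall F0 F, A F0 -> (forall i, A (F i)) ->
        (forall x, F0 x + \sum_i F i x * w i x = 0) ->
        forall x, F0 x * a x + \sum_i F i x * L i x = 0].
Proof.
move=> Ac AD AM.
have AN f : A f -> A (fun x => - f x).
  by move=> Af; rewrite (_ : (fun x => - f x) = fun x => -1 * f x);
    [exact: (AM (fun=> -1))|apply/funext => x; rewrite mulN1r].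
have Asum m (F : 'I_m -> T -> k) : (forall i, A (F i)) -> A (fun x => \sum_i F i x).
  elim: m F => [|m IHm] F AF.
    by rewrite (_ : (fun x => _) = fun=> 0) //; apply/funext => x; rewrite big_ord0.
  rewrite (_ : (fun x => _) = fun x => F ord0 x + \sum_i F (lift ord0 i) x).
    by apply: AD => //; exact: IHm.
  by apply/funext => x; rewrite big_ord_recl.
elim: n w => [|n IHn] w.
  exists (fun=> 1), (fun _ _ => 0); split => //; first by exists x0; rewrite oner_neq0.
  by move=> F0 F _ _ F0w x; rewrite big_ord0 addr0 mulr1; have := F0w x; rewrite big_ord0 addr0.
have [a [L [Aa [x1 ax1] AL rel]]] := IHn (fun i => w (lift ord0 i)).
pose relation F0 F c := [/\ A F0, forall i : 'I_n, A (F i), A c &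
  forall x, F0 x + \sum_i F i x * w (lift ord0 i) x + c x * w ord0 x = 0].
(* Since [A] may have zero divisors, the test is on [c * a]. If it is nonzero, scale the form by [c]
   and give [w ord0] the value which the relation imposes. *)
have [[F0 [F [c [[AF0 AF Ac' r] [x2 cax2]]]]]|norel] :=
    pselect (exists F0 F c, relation F0 F c /\ exists x, c x * a x != 0).
  exists (fun x => c x * a x), (fun i x => if unlift ord0 i is Some j then c x * L j x
    else - (F0 x * a x + \sum_j F j x * L j x)); split.
  - exact: AM.
  - by exists x2.
  - move=> i; case: unliftP => [j|] _; first exact: AM.
    apply/AN/AD; first exact: AM.
    by apply: Asum => j; exact: AM.
  move=> G0 G AG0 AG rG x.
  have AB f g : A f -> A g -> A (fun x => f x - g x).
    by move=> Af Ag; apply: AD => //; exact: AN.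
  have E : (c x * G0 x - G ord0 x * F0 x) * a x +
      (c x * (\sum_i G (lift ord0 i) x * L i x) - G ord0 x * \sum_i F i x * L i x) = 0.
    rewrite !mulr_sumr -sumrB; under eq_bigr do rewrite !mulrA -mulrBl.
    apply: (rel (fun x => c x * G0 x - G ord0 x * F0 x)
                (fun i x => c x * G (lift ord0 i) x - G ord0 x * F i x)) => [|i|y].
    + by apply: AB; exact: AM.
    + by apply: AB; exact: AM.
    have := rG y; rewrite big_ord_recl => rGy; have ry := r y.
    under eq_bigr do rewrite mulrBl -!mulrA.
    rewrite sumrB -!mulr_sumr.
    move: rGy ry; set s := \sum_i _; set t := \sum_i _ => rGy ry.
    have -> : c y * G0 y - G ord0 y * F0 y + (c y * s - G ord0 y * t) =
      c y * (G0 y + (G ord0 y * w ord0 y + s)) - G ord0 y * (F0 y + t + c y * w ord0 y) by ring.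
    by rewrite rGy ry !mulr0 subrr.
  rewrite big_ord_recl unlift_none.
  rewrite [X in _ + (_ + X)](eq_bigr (fun i => c x * (G (lift ord0 i) x * L i x))); last first.
    by move=> i _; rewrite liftK mulrCA.
  rewrite -mulr_sumr; move: E; set s := \sum_i _; set t := \sum_i _ => E.
  by rewrite -[RHS]E; ring.
have ca F0 F c : relation F0 F c -> forall x, c x * a x = 0.
  move=> r x; apply/eqP/negPn/negP => cx; apply: norel; exists F0, F, c; split => //.
  by exists x.
(* Now [a] kills the coefficient of [w ord0] in every relation, so after scaling the form by [a] the
   new generator can be sent to 0. *)
exists (fun x => a x * a x), (fun i x => if unlift ord0 i is Some j then a x * L j x else 0).
split.
- exact: AM.
- by exists x1; rewrite mulf_neq0.
- by move=> i; case: unliftP => [j|] _; [exact: AM|exact: Ac].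
move=> G0 G AG0 AG rG x.
have ga : forall y, G ord0 y * a y = 0.
  apply: (ca G0 (fun i => G (lift ord0 i))); split => // y.
  by have := rG y; rewrite big_ord_recl (addrC (G ord0 y * _)) addrA.
have E : a x * G0 x * a x + \sum_i a x * G (lift ord0 i) x * L i x = 0.
  apply: (rel (fun x => a x * G0 x) (fun i x => a x * G (lift ord0 i) x)) => [|i|y].
  - exact: AM.
  - exact: AM.
  under eq_bigr do rewrite -mulrA.
  have := rG y; rewrite -mulr_sumr big_ord_recl; set s := \sum_i _ => rGy.
  have -> : a y * G0 y + a y * s =
      a y * (G0 y + (G ord0 y * w ord0 y + s)) - G ord0 y * a y * w ord0 y by ring.
  by rewrite rGy ga mul0r mulr0 subrr.
rewrite big_ord_recl unlift_none mulr0 add0r -[RHS]E.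
congr (_ + _); first by ring.
by apply: eq_bigr => i _; rewrite liftK; ring.
Qed.

Lemma nonzero_linear_form (k : closedFieldType) (T : Type) (A : set (T -> k)) (x0 : T)
    (I : finType) (w : I -> T -> k) : subalgebra A ->
  exists (a : T -> k) (L : I -> T -> k),
    [/\ A a, exists x, a x != 0, forall i, A (L i) &
      forall F0 F, A F0 -> (forall i, A (F i)) ->
        (forall x, F0 x + \sum_i F i x * w i x = 0) ->
        forall x, F0 x * a x + \sum_i F i x * L i x = 0].
Proof.
move=> Aalg.
have [|||a [L [Aa a0 AL rel]]] := @nonzero_linear_form_ord k T A x0 #|I| (fun i => w (enum_val i)).
- exact: subalg_cst.
- by move=> f g; exact: subalgD.
- by move=> f g; exact: subalgM.
exists a, (fun i => L (enum_rank i)); split => // F0 F AF0 AF r x.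
rewrite (reindex _ (onW_bij _ (enum_val_bij I))) /=.
under eq_bigr do rewrite enum_valK.
apply: (rel F0 (fun i => F (enum_val i))) => // y.
by rewrite -[RHS](r y) [in RHS](reindex _ (onW_bij _ (enum_val_bij I))).
Qed.

(** * The quotient monoid *)

Lemma zopenP (k : closedFieldType) (X : funSpace k) (U : set X) :
  zopen U <-> forall x, U x ->
    exists f, [/\ reg X f, f x != 0 & forall y, f y != 0 -> U y].
Proof.
split => [[S SX SE] x Ux|UX].
  have : ~ (~` U) x by move=> /(_ Ux).
  rewrite SE => /existsNP[f /not_implyP[Sf fx]].
  exists f; split; [exact: SX|exact/eqP|] => y fy; apply: contrapT => Uy.
  have : (~` U) y by [].
  by rewrite SE => /(_ _ Sf) fy0; rewrite fy0 eqxx in fy.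
exists [set f | reg X f /\ forall y, ~ U y -> f y = 0]; first by move=> f [].
apply/seteqP; split => [x Ux f [_]|x /= xS Ux]; first exact.
have [f [rf fx fU]] := UX _ Ux; move/eqP: fx; apply; apply: xS; split => // y Uy.
by apply/eqP/negPn/negP => /fU.
Qed.

Section Quotient.
Variables (k : closedFieldType) (M : funSpace k) (mul : M -> M -> M) (one : M).
Variable H : set M.
Hypothesis Mmon : affine_monoid mul one.
Hypothesis Mcomp : forall Z : set M, irreducible_component Z ->
  exists g : M, Z g /\ unit_group mul one g.
Hypothesis Hnormal : normal_subgroup mul one H.
Hypothesis Hclosed : zclosed H.

Local Notation "x ** y" := (mul x y) (at level 40, left associativity).
Local Notation unit := (unit_group mul one).
Local Notation A := (invariants mul H).
Local Notation N := (aff_quotient mul H).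
Local Notation p := (aff_proj mul H).

Let Malg : subalgebra (reg M) := reg_subalg Mmon.
Let H1 : H one := normal1 Hnormal.
Let HU h : H h -> unit h.
Proof. by case: Hnormal => HU _ _ _ _; exact: HU. Qed.
Let HM h h' : H h -> H h' -> H (h ** h').
Proof. by case: Hnormal => _ _ HM _ _; exact: HM. Qed.

Lemma invariants_subalg : subalgebra A.
Proof.
split.
- by move=> c; split => //; exact: subalg_cst.
- move=> f g [rf fH] [rg gH]; split; first exact: (subalgD Malg).
  by move=> h Hh; rewrite -[in RHS](fH h Hh) -[in RHS](gH h Hh).
- move=> f g [rf fH] [rg gH]; split; first exact: (subalgM Malg).
  by move=> h Hh; rewrite -[in RHS](fH h Hh) -[in RHS](gH h Hh).
Qed.

Let Aalg := invariants_subalg.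

Lemma invariantl f h x : A f -> H h -> f (h ** x) = f x.
Proof. by move=> [_ fH] Hh; rewrite -[in RHS](fH h Hh). Qed.

(** For a unit [x], normality moves [h] to the left, where invariance absorbs it; the units are
    dense. *)
Lemma invariant_mid f h x y : A f -> H h -> f (x ** h ** y) = f (x ** y).
Proof.
move=> Af Hh; have [rf _] := Af; apply/eqP; rewrite -subr_eq0; apply/eqP.
apply: (units_dense Mmon Mcomp (f := fun x => f (x ** h ** y) - f (x ** y))).
  apply: (subalgB Malg); last exact: (reg_mulr Mmon y rf).
  exact: (reg_mulr Mmon h (reg_mulr Mmon y rf)).
move=> g [g' [gg' g'g]].
rewrite -(invariantl (g ** y) Af (normal_conj Hnormal gg' g'g Hh)).
by rewrite -!(mon_mulA Mmon) (mon_mulA Mmon g' g) g'g (mon_mul1 Mmon) subrr.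
Qed.

Lemma invariants_mulr f y : A f -> A (fun x => f (x ** y)).
Proof.
move=> Af; have [rf _] := Af; split; first exact: (reg_mulr Mmon).
by move=> h Hh; apply/funext => x /=; rewrite -(mon_mulA Mmon) invariantl.
Qed.

Lemma invariants_mull f x : A f -> A (fun y => f (x ** y)).
Proof.
move=> Af; have [rf _] := Af; split; first exact: (reg_mull Mmon).
by move=> h Hh; apply/funext => y /=; rewrite (mon_mulA Mmon) invariant_mid.
Qed.

(** The [b i] are picked among the translates [f (x ** _)], invariant by normality; the [a i] are
    combinations of the invariants [f (_ ** y j)]. *)
Lemma invariants_comult f : A f ->
  exists n (a b : 'I_n -> M -> k),
    [/\ forall i, A (a i), forall i, A (b i) &
        forall x y, f (x ** y) = \sum_i a i x * b i y].
Proof.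
move=> Af; have [rf _] := Af; have [n [a [b [_ _ fE]]]] := reg_comult Mmon rf.
pose U := [set v | exists x, v = fun y => f (x ** y)].
have [|d [u [y [Uu uy Uc]]]] := @function_basis k M U 'I_n b.
  by move=> _ [x ->]; exists (a^~ x) => y; rewrite fE.
set W := \matrix_(i, j) u i (y j) in uy.
exists d, (fun i x => \sum_j f (x ** y j) * invmx W j i), u; split.
- move=> i; apply: (subalg_sum Aalg) => j _.
  apply: (subalgM Aalg); last exact: (subalg_cst Aalg).
  exact: invariants_mulr.
- by move=> i; have [x ->] := Uu i; exact: invariants_mull.
move=> x z; have [|c cE] := Uc (fun y => f (x ** y)); first by exists x.
rewrite cE; apply: eq_bigr => i _; congr (_ * _).
have -> : c = (\row_j f (x ** y j)) *m invmx W.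
  apply: (canRL (mulmxK uy)); apply/rowP => j; rewrite !mxE cE.
  by apply: eq_bigr => l _; rewrite !mxE.
by rewrite mxE; apply: eq_bigr => j _; rewrite mxE.
Qed.

Lemma translate_right (psi : N) f : A f -> A (fun x => spec_val psi (fun y => f (x ** y))).
Proof.
move=> Af; have [n [a [b [Aa Ab fE]]]] := invariants_comult Af.
have := subalg_sum Aalg (index_enum 'I_n) (P := xpredT)
  (fun i _ => subalgZ Aalg (spec_val psi (b i)) (Aa i)).
move/subalg_eq; apply=> x.
have -> : (fun y => f (x ** y)) = fun y => \sum_i a i x * b i y by apply/funext.
rewrite (spec_val_sum Aalg); last by move=> i; exact: subalgZ.
by apply: eq_bigr => i _; rewrite (spec_valZ Aalg) // mulrC.
Qed.

Lemma convolution_sum (phi psi : N) f n (a b : 'I_n -> M -> k) :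
  (forall i, A (a i)) -> (forall i, A (b i)) ->
  (forall x y, f (x ** y) = \sum_i a i x * b i y) ->
  spec_val phi (fun x => spec_val psi (fun y => f (x ** y))) =
  \sum_i spec_val phi (a i) * spec_val psi (b i).
Proof.
move=> Aa Ab fE.
have -> : (fun x => spec_val psi (fun y => f (x ** y))) =
    fun x => \sum_i spec_val psi (b i) * a i x.
  apply/funext => x.
  have -> : (fun y => f (x ** y)) = fun y => \sum_i a i x * b i y by apply/funext.
  rewrite (spec_val_sum Aalg); last by move=> i; exact: subalgZ.
  by apply: eq_bigr => i _; rewrite (spec_valZ Aalg) // mulrC.
rewrite (spec_val_sum Aalg); last by move=> i; exact: subalgZ.
by apply: eq_bigr => i _; rewrite (spec_valZ Aalg) // mulrC.
Qed.

Lemma convolutionC (phi psi : N) f : A f ->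
  spec_val phi (fun x => spec_val psi (fun y => f (x ** y))) =
  spec_val psi (fun y => spec_val phi (fun x => f (x ** y))).
Proof.
move=> Af; have [n [a [b [Aa Ab fE]]]] := invariants_comult Af.
rewrite (convolution_sum _ _ Aa Ab fE).
have -> : (fun y => spec_val phi (fun x => f (x ** y))) =
    fun y => \sum_i spec_val phi (a i) * b i y.
  apply/funext => y.
  have -> : (fun x => f (x ** y)) = fun x => \sum_i b i y * a i x.
    by apply/funext => x; rewrite fE; apply: eq_bigr => i _; rewrite mulrC.
  rewrite (spec_val_sum Aalg); last by move=> i; exact: subalgZ.
  by apply: eq_bigr => i _; rewrite (spec_valZ Aalg) // mulrC.
rewrite (spec_val_sum Aalg); last by move=> i; exact: subalgZ.
by apply: eq_bigr => i _; rewrite (spec_valZ Aalg).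
Qed.

Lemma translate_left (phi : N) f : A f -> A (fun y => spec_val phi (fun x => f (x ** y))).
Proof.
move=> Af; have [n [a [b [Aa Ab fE]]]] := invariants_comult Af.
have := subalg_sum Aalg (index_enum 'I_n) (P := xpredT)
  (fun i _ => subalgZ Aalg (spec_val phi (a i)) (Ab i)).
move/subalg_eq; apply=> y.
have -> : (fun x => f (x ** y)) = fun x => \sum_i b i y * a i x.
  by apply/funext => x; rewrite fE; apply: eq_bigr => i _; rewrite mulrC.
rewrite (spec_val_sum Aalg); last by move=> i; exact: subalgZ.
by apply: eq_bigr => i _; rewrite (spec_valZ Aalg) // mulrC.
Qed.

Lemma convolution_exists : exists mulQ : N -> N -> N, forall phi psi f, A f ->
  spec_val (mulQ phi psi) f = spec_val phi (fun x => spec_val psi (fun y => f (x ** y))).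
Proof.
have : forall q : N * N, exists chi : N, forall f, A f ->
    spec_val chi f = spec_val q.1 (fun x => spec_val q.2 (fun y => f (x ** y))).
  move=> [phi psi] /=.
  pose Phi f := spec_val phi (fun x => spec_val psi (fun y => f (x ** y))).
  have [|||chi chiE] := spec_point (A := A) (Phi := Phi); last by exists chi.
  - move=> c; rewrite /Phi -[RHS](spec_val_cst Aalg phi c); congr spec_val.
    by apply/funext => x; rewrite (spec_val_cst Aalg).
  - move=> f g Af Ag; rewrite /Phi -(spec_valD Aalg); [|exact: translate_right..].
    by congr spec_val; apply/funext => x; rewrite (spec_valD Aalg) //; exact: invariants_mull.
  - move=> f g Af Ag; rewrite /Phi -(spec_valM Aalg); [|exact: translate_right..].
    by congr spec_val; apply/funext => x; rewrite (spec_valM Aalg) //; exact: invariants_mull.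
by move=> /choice[m mE]; exists (fun phi psi => m (phi, psi)) => phi psi f /(mE (phi, psi)).
Qed.

Variable mulQ : N -> N -> N.
Hypothesis mulQE : forall phi psi f, A f ->
  spec_val (mulQ phi psi) f = spec_val phi (fun x => spec_val psi (fun y => f (x ** y))).

Lemma spec_val_proj x f : A f -> spec_val (p x) f = f x.
Proof. exact: spec_val_ev. Qed.

Lemma projM x y : p (x ** y) = mulQ (p x) (p y).
Proof.
apply: spec_eq => f Af; rewrite mulQE //.
have -> : (fun x => spec_val (p y) (fun y => f (x ** y))) = fun x => f (x ** y).
  by apply/funext => z; rewrite spec_val_proj //; exact: invariants_mull.
by rewrite !spec_val_proj //; exact: invariants_mulr.
Qed.

Lemma mulQ_induced : induced_product mulQ.
Proof.
move=> f; have Af : A (val f) := set_mem (svalP f).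
have [n [a [b [Aa Ab fE]]]] := invariants_comult Af.
exists n, (fun i => SigSub (mem_set (Aa i))), (fun i => SigSub (mem_set (Ab i))).
split => // phi psi; rewrite -spec_valE mulQE // (convolution_sum _ _ Aa Ab fE).
by apply: eq_bigr => i _; rewrite -!spec_valE.
Qed.

Lemma mulQ_monoid : finitely_generated A -> affine_monoid mulQ (p one).
Proof.
move=> fgA; split.
- exact: spec_affine.
- move=> phi psi chi; apply: spec_eq => f Af.
  rewrite mulQE // mulQE // [RHS]mulQE; last exact: translate_right.
  congr spec_val; apply/funext => x; rewrite mulQE; last exact: invariants_mull.
  congr spec_val; apply/funext => y; congr spec_val; apply/funext => z.
  by rewrite (mon_mulA Mmon).
- move=> phi; apply: spec_eq => f Af.
  rewrite mulQE // spec_val_proj; last exact: translate_right.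
  by congr spec_val; apply/funext => y; rewrite (mon_mul1 Mmon).
- move=> phi; apply: spec_eq => f Af; rewrite mulQE //.
  congr spec_val; apply/funext => x; rewrite spec_val_proj; last exact: invariants_mull.
  by rewrite (mon_1mul Mmon).
- move=> _ /reg_specP[f Af ->].
  have [n [a [b [Aa Ab fE]]]] := invariants_comult Af.
  exists n, (fun i => SigSub (mem_set (reg_spec (Aa i)))), (fun i => SigSub (mem_set (reg_spec (Ab i)))).
  by move=> [phi psi] /=; rewrite mulQE // (convolution_sum _ _ Aa Ab fE).
Qed.

Lemma proj_unit x : unit x -> unit_group mulQ (p one) (p x).
Proof. by move=> [y [xy yx]]; exists (p y); rewrite -!projM xy yx. Qed.

(* If [1] were in the ideal generated by the maximal ideal of [phi], then so
   would the translated relations; a nonzero linear form [L] as in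
   [nonzero_linear_form] shows that [phi (a (_ ** g)) = 0] for all units [g], so
   [a] vanishes on the orbit of the unit [phi], which is everything. *)
Lemma unit_fibre_proper (phi : N) (I : finType) (F a : I -> M -> k) :
  unit_group mulQ (p one) phi -> (forall i, A (F i)) -> (forall i, reg M (a i)) ->
  (forall i, spec_val phi (F i) = 0) -> ~ forall x, \sum_i F i x * a i x = 1.
Proof.
move=> [psi [phipsi _]] AF ra phiF sum1.
(* The number of terms in the comultiplication of [a i] depends on [i]; the dependent pairs [J]
   below flatten the double sum. *)
have : forall i, exists t : {n : nat & (('I_n -> M -> k) * ('I_n -> M -> k))%type},
    forall x y, a i (x ** y) = \sum_l (tagged t).1 l x * (tagged t).2 l y.
  move=> i; have [n [b [c [_ _ aE]]]] := reg_comult Mmon (ra i).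
  by exists (Tagged (fun n => (('I_n -> M -> k) * ('I_n -> M -> k))%type) (b, c)).
move=> /choice[t tE].
pose J : finType := {i : I & 'I_(tag (t i))}.
pose w (s : J) := (tagged (t (tag s))).1 (tagged s).
pose c (s : J) := (tagged (t (tag s))).2 (tagged s).
have [al [L [Aal [x0 al0] AL rel]]] := nonzero_linear_form one w Aalg.
have van g : unit g -> spec_val phi (fun x => al (x ** g)) = 0.
  move=> [g' [gg' g'g]].
  (* Translation by [g'] writes 1 as an [A]-combination of the fixed functions [w s], and the linear
     form turns this into a formula for [al]. Translated back by [g], its coefficients [F] are
     killed by [phi]. *)
  have alE x : al x = \sum_(s : J) (F (tag s) (x ** g') * c s g') * L s x.
    have := rel (fun=> -1) (fun s x => F (tag s) (x ** g') * c s g').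
    move=> /(_ (subalg_cst Aalg _))/(_ _ _ x); rewrite mulN1r => E.
    apply/eqP; rewrite -subr_eq0 -oppr_eq0 opprB addrC; apply/eqP/E.
    - move=> s; apply: (subalgM Aalg); last exact: (subalg_cst Aalg).
      exact: invariants_mulr.
    - move=> y; rewrite -(sum1 (y ** g')) addrC; apply/eqP; rewrite subr_eq0; apply/eqP.
      under [RHS]eq_bigr do rewrite tE mulr_sumr.
      rewrite sig_big_dep /=.
      by apply: eq_bigr => s _; rewrite /w /c; ring.
  have -> : (fun x => al (x ** g)) =
      fun x => \sum_(s : J) F (tag s) x * (c s g' * L s (x ** g)).
    apply/funext => x; rewrite alE; apply: eq_bigr => s _.
    by rewrite -(mon_mulA Mmon) gg' (mon_1mul Mmon) mulrA.
  have AcL s : A (fun x => c s g' * L s (x ** g)).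
    by apply: subalgZ => //; exact: invariants_mulr.
  rewrite (spec_val_sum Aalg); last by move=> s; exact: subalgM.
  by rewrite big1 // => s _; rewrite (spec_valM Aalg) // phiF mul0r.
have van' : (fun y => spec_val phi (fun x => al (x ** y))) = fun=> 0.
  apply/funext; apply: (units_dense Mmon Mcomp) => //.
  by have [] := translate_left phi Aal.
have /eqP := al0; apply; rewrite -(spec_val_proj x0 Aal).
(* Since [phi] is invertible, every point is a product with left factor [phi]. *)
have -> : p x0 = mulQ phi (mulQ psi (p x0)).
  apply: spec_eq => f Af; rewrite !mulQE //.
  rewrite -{1}(mon_mul1 Mmon x0) projM -phipsi !mulQE //; last exact: translate_right.
  congr spec_val; apply/funext => x; rewrite mulQE; last exact: invariants_mull.
  congr spec_val; apply/funext => y; congr spec_val; apply/funext => z.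
  by rewrite (mon_mulA Mmon).
by rewrite mulQE // convolutionC // van' (spec_val_cst Aalg).
Qed.

(** A common zero in [M] of the kernel of [phi] lies over [phi], and the invariant character [e]
    shows that it is a unit. *)
Lemma proj_units_surjective (phi : N) : unit_group mulQ (p one) phi ->
  exists2 x, unit x & p x = phi.
Proof.
move=> phiU; have Maff : affine_variety M by case: Mmon.
have [e [Ae e1 eM eU]] := invariant_unit_character Mmon Mcomp Hnormal Hclosed.
pose I := [set u | exists (J : finType) (F a : J -> M -> k),
  [/\ forall i, A (F i), forall i, reg M (a i), forall i, spec_val phi (F i) = 0 &
      u = fun x => \sum_i F i x * a i x]].
have Iid : ideal I.
  split.
  - move=> _ [J [F [a [AF ra _ ->]]]]; apply: (subalg_sum Malg) => i _.
    by apply: (subalgM Malg) => //; have [] := AF i.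
  - exists void, (fun _ _ => 0), (fun _ _ => 0); split; [by case..|].
    by apply/funext => x; rewrite big1 // => -[].
  - move=> _ _ [J [F [a [AF ra F0 ->]]]] [J' [F' [a' [AF' ra' F0' ->]]]].
    exists (J + J')%type, (fun s => match s with inl i => F i | inr i => F' i end).
    exists (fun s => match s with inl i => a i | inr i => a' i end); split; try by case.
    by apply/funext => x; rewrite big_sumType.
  - move=> b _ rb [J [F [a [AF ra F0 ->]]]].
    exists J, F, (fun i x => b x * a i x); split => //.
      by move=> i; exact: (subalgM Malg).
    by apply/funext => x /=; rewrite mulr_sumr; apply: eq_bigr => i _; rewrite mulrCA.
have [|x xI] := zero_of_proper_ideal Maff Iid.
  move=> [J [F [a [AF ra F0 /esym E]]]].
  by apply: (unit_fibre_proper phiU AF ra F0) => x; rewrite -[RHS]/((fun=> 1) x) -E.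
have px : p x = phi.
  apply: spec_eq => f Af; rewrite spec_val_proj //.
  apply/eqP; rewrite -subr_eq0; apply/eqP.
  pose f0 x := f x - spec_val phi f.
  apply: (xI f0); exists 'I_1, (fun=> f0), (fun _ _ => 1); split => //.
  - by move=> _; apply: (subalgB Aalg) => //; exact: (subalg_cst Aalg).
  - by move=> _; exact: (subalg_cst Malg).
  - move=> _; rewrite /f0 (spec_valD Aalg) //; last exact: (subalg_cst Aalg).
    by rewrite (spec_val_cst Aalg) subrr.
  - by apply/funext => y; rewrite big_ord1 mulr1.
exists x => //; apply/eU; rewrite -(spec_val_proj x Ae) px.
have [psi [phipsi _]] := phiU.
(* If [phi] killed the multiplicative [e], so would [mulQ phi psi], which is [p one] and takes the
   value 1 at [e]. *)
apply: contra_neq (oner_neq0 k) => phie.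
rewrite -e1 -(spec_val_proj one Ae) -phipsi mulQE // convolutionC //.
have -> : (fun y => spec_val phi (fun x => e (x ** y))) = fun=> 0.
  apply/funext => y.
  have -> : (fun x => e (x ** y)) = fun x => e y * e x.
    by apply/funext => z; rewrite eM mulrC.
  by rewrite (spec_valZ Aalg) // phie mulr0.
by rewrite (spec_val_cst Aalg).
Qed.

(** If [x] is not in the coset of [y], a translated equation of [H] vanishes on the coset but not at
    [x]; [observable_at], for the stable ideal of the coset, turns it into an invariant separating
    [x] from [y]. *)
Lemma proj_fibres x y : unit x -> unit y ->
  p x = p y <-> exists2 h, H h & x = h ** y.
Proof.
move=> ux uy; split => [pxy|[h Hh ->]]; last first.
  by apply: spec_eq => f Af; rewrite !spec_val_proj // invariantl.
have [y' [yy' y'y]] := uy.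
have [Hxy|Hxy] := pselect (H (x ** y')).
  by exists (x ** y') => //; rewrite -(mon_mulA Mmon) y'y (mon_1mul Mmon).
exfalso; have [S SM HE] := Hclosed.
have [s [Ss sxy]] : exists s, S s /\ s (x ** y') <> 0.
  apply: contrapT => no; apply: Hxy; rewrite HE => s Ss; apply: contrapT => sxy.
  by apply: no; exists s.
pose I := [set F : M -> k | reg M F /\ forall h, H h -> F (h ** y) = 0].
have [||||f [[_ fH] Af] fx] := @observable_at k M mul one H Mmon Mcomp Hnormal Hclosed I x.
- split.
  + by move=> F [].
  + by split => //; exact: (subalg_cst Malg).
  + move=> F G [rF FH] [rG GH]; split; first exact: (subalgD Malg).
    by move=> h Hh /=; rewrite FH // GH // addr0.
  + move=> F G rF [rG GH]; split; first exact: (subalgM Malg).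
    by move=> h Hh /=; rewrite GH // mulr0.
- move=> h F Hh [rF FH]; split; first exact: (reg_mull Mmon).
  by move=> h' Hh' /=; rewrite (mon_mulA Mmon) FH //; exact: HM.
- by [].
- exists (fun z => s (z ** y')); last exact/eqP.
  split; first by apply: (reg_mulr Mmon); exact: SM.
  move=> h Hh; rewrite -(mon_mulA Mmon) yy' (mon_1mul Mmon).
  by move: Hh; rewrite HE; exact.
move/eqP: fx; apply; rewrite -(spec_val_proj x Af) pxy spec_val_proj //.
by rewrite -(mon_mul1 Mmon y); exact: fH.
Qed.

(** * Open sets and regular functions on the quotient group *)

Section OpenSets.
Hypothesis fgA : finitely_generated A.
Variable V : set N.
Hypothesis VN : V `<=` unit_group mulQ (p one).

Let U := unit `&` p @^-1` V.

Let U_translate h y : H h -> U (h ** y) <-> U y.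
Proof.
move=> Hh; have [h' [hh' h'h]] := HU Hh.
have ph : p (h ** y) = p y.
  by apply: spec_eq => f Af; rewrite !spec_val_proj // invariantl.
split => [[uhy Vhy]|[uy Vy]]; split.
- have -> : y = h' ** (h ** y) by rewrite (mon_mulA Mmon) h'h (mon_mul1 Mmon).
  by apply: (unit_mul Mmon) => //; exists h.
- by rewrite /= -ph.
- by apply: (unit_mul Mmon) => //; exact: HU.
- by rewrite /= ph.
Qed.

(** [U] is a union of cosets of [H], so the ideal of functions vanishing off [U] is stable. *)
Lemma invariant_in_open x : zopen U -> U x ->
  exists f, [/\ A f, f x != 0 & forall y, f y != 0 -> U y].
Proof.
move=> /zopenP Uo Ux; have [g [rg gx gU]] := Uo _ Ux.
pose I := [set f | reg M f /\ forall y, ~ U y -> f y = 0].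
have [||||f [[rf fU] Af] fx] := @observable_at k M mul one H Mmon Mcomp Hnormal Hclosed I x.
- split.
  + by move=> F [].
  + by split => //; exact: (subalg_cst Malg).
  + move=> F G [rF FU] [rG GU]; split; first exact: (subalgD Malg).
    by move=> y Uy /=; rewrite FU // GU // addr0.
  + move=> F G rF [rG GU]; split; first exact: (subalgM Malg).
    by move=> y Uy /=; rewrite GU // mulr0.
- move=> h F Hh [rF FU]; split; first exact: (reg_mull Mmon).
  by move=> y Uy /=; apply: FU => /(U_translate _ Hh).
- by case: Ux.
- exists g => //; split => // y Uy; apply/eqP/negPn/negP => gy.
  by apply: Uy; exact: gU.
exists f; split => // y fy; apply: contrapT => /fU fy0.
by rewrite fy0 eqxx in fy.
Qed.

Lemma proj_open : zopen V <-> zopen U.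
Proof.
split => [/zopenP Vo|Uo]; apply/zopenP.
  move=> x [ux Vx]; have [_ [/reg_specP[f Af ->] fx fV]] := Vo _ Vx.
  have [d [rd _ _ dU]] := unit_character Mmon; have [rf _] := Af.
  exists (fun y => f y * d y); split.
  - exact: (subalgM Malg).
  - by rewrite mulf_neq0 //; [rewrite -spec_val_proj|apply/dU].
  - move=> y; rewrite mulf_eq0 negb_or => /andP[fy dy]; split; first exact/dU.
    by apply: fV; rewrite spec_val_proj.
move=> v Vv; have [x ux xv] := proj_units_surjective (VN Vv).
have Ux : U x by split => //=; rewrite xv.
have [f [Af fx fU]] := invariant_in_open Uo Ux.
(* The factor [D] confines the nonvanishing locus to the units of the quotient, over which [p] is
   surjective. *)
have [_ [/reg_specP[D AD ->] _ _ DN]] := unit_character (mulQ_monoid fgA).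
exists (fun phi => spec_val phi (fun y => f y * D y)); split.
- by apply: reg_spec; exact: (subalgM Aalg).
- rewrite (spec_valM Aalg) // mulf_neq0 //; last exact/DN/VN.
  by rewrite -xv spec_val_proj.
- move=> phi; rewrite (spec_valM Aalg) // mulf_eq0 negb_or => /andP[fphi /DN phiU].
  have [y uy yphi] := proj_units_surjective phiU.
  have [_] : U y by apply: fU; rewrite -spec_val_proj // yphi.
  by rewrite /= yphi.
Qed.

(** For descent, the denominators of [f \o p] on [U] form a stable ideal [J], so [observable_at]
    provides an invariant denominator that is nonzero at [x]. *)
Lemma proj_regular (f : N -> k) : zopen V -> regular_on V f <-> regular_on U (f \o p).
Proof.
move=> Vo; have Uo := proj_open.1 Vo.
split => [fV x [ux Vx]|fU v Vv].
  have [_ [_ [/reg_specP[a Aa ->] /reg_specP[b Ab ->] bx fE]]] := fV _ Vx.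
  have [ra _] := Aa; have [rb _] := Ab.
  exists a, b; split => //; first by rewrite -(spec_val_proj x Ab).
  by move=> y [uy Vy] bY; rewrite /= fE ?spec_val_proj.
have [x ux xv] := proj_units_surjective (VN Vv).
have Ux : U x by split => //=; rewrite xv.
have [a [b [ra rb bx fE]]] := fU _ Ux.
pose J := [set be | reg M be /\ exists2 al, reg M al & forall y, U y -> be y * f (p y) = al y].
have ph h y : H h -> p (h ** y) = p y.
  by move=> Hh; apply: spec_eq => g Ag; rewrite !spec_val_proj // invariantl.
have [||||be [[rbe [al ral alE]] Abe] bex] := @observable_at k M mul one H Mmon Mcomp Hnormal Hclosed J x.
- split.
  + by move=> F [].
  + split; first exact: (subalg_cst Malg).
    by exists (fun=> 0); [exact: (subalg_cst Malg)|move=> y _; rewrite mul0r].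
  + move=> F G [rF [F' rF' FE]] [rG [G' rG' GE]]; split; first exact: (subalgD Malg).
    exists (F' \+ G'); first exact: (subalgD Malg).
    by move=> y Uy /=; rewrite mulrDl FE // GE.
  + move=> F G rF [rG [G' rG' GE]]; split; first exact: (subalgM Malg).
    exists (F \* G'); first exact: (subalgM Malg).
    by move=> y Uy /=; rewrite -mulrA GE.
- move=> h F Hh [rF [F' rF' FE]]; split; first exact: (reg_mull Mmon).
  exists (fun y => F' (h ** y)); first exact: (reg_mull Mmon).
  by move=> y Uy /=; rewrite -FE ?ph //; exact/U_translate.
- by [].
(* The square is taken because [f] is given by [a / b] only where [b] is nonzero; with [b \* b] the
   identity holds on all of [U]. *)
- exists (b \* b); last by rewrite /= mulf_neq0.
  split; first exact: (subalgM Malg).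
  exists (a \* b); first exact: (subalgM Malg).
  move=> y Uy /=; have [->|by0] := eqVneq (b y) 0; first by rewrite !mulr0 mul0r.
  by have /= -> := fE _ Uy by0; field.
(* The numerator [al] is controlled on [U] only; the invariant [c], which vanishes off [U], makes
   [c * al] invariant everywhere. *)
have [c [Ac cx cU]] := invariant_in_open Uo Ux.
have Aca : A (fun y => c y * al y).
  split; first by apply: (subalgM Malg) => //; have [] := Ac.
  move=> h Hh; apply/funext => y /=; rewrite invariantl //.
  have [Uy|Uy] := pselect (U y).
    congr (_ * _); rewrite -!alE ?ph ?(invariantl y Abe) //.
    exact/U_translate.
  suff -> : c y = 0 by rewrite !mul0r.
  by apply/eqP/negPn/negP => /cU.
exists (fun phi => spec_val phi (fun y => c y * al y)), (fun phi => spec_val phi (fun y => c y * be y)).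
have Acb : A (fun y => c y * be y) by exact: subalgM.
split; [exact: reg_spec..|by rewrite -xv spec_val_proj // mulf_neq0|].
move=> w' Vw; have [y uy yw] := proj_units_surjective (VN Vw).
rewrite -yw !spec_val_proj // mulf_eq0 negb_or => /andP[cy bey].
rewrite -alE; last by split => //=; rewrite yw.
by field; rewrite cy bey.
Qed.

End OpenSets.

End Quotient.

(* [Mcomp] is trivial for irreducible [M] (take [1]); without it the first
   claim fails on components of [M] that contain no unit. *)
Theorem theorem4p4 (k : closedFieldType) (M : funSpace k)
    (mul : M -> M -> M) (one : M) (H : set M)
    (Mmon : affine_monoid mul one)
    (Mcomp : forall Z : set M, irreducible_component Z ->
       exists g : M, Z g /\ unit_group mul one g)
    (Hnormal : normal_subgroup mul one H)
    (Hclosed : zclosed H) :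
  observable mul H /\
  (finitely_generated (invariants mul H) ->
   exists mulQ : aff_quotient mul H -> aff_quotient mul H -> aff_quotient mul H,
     let oneQ := aff_proj mul H one in
     [/\ induced_product mulQ,
         affine_monoid mulQ oneQ &
         unit_group_quotient mul one mulQ oneQ H (aff_proj mul H)]).
Proof.
split => [|fgA]; first exact: (normal_observable Mmon).
have [mulQ mulQE] := convolution_exists Mmon Mcomp Hnormal.
exists mulQ => oneQ; split.
- exact: (mulQ_induced Mmon Mcomp Hnormal).
- exact: (mulQ_monoid Mmon Mcomp Hnormal).
split.
- apply/seteqP; split => [_ [x ux <-]|phi phiU]; first exact: (proj_unit Mmon Mcomp Hnormal mulQE).
  by have [x ux <-] := proj_units_surjective Mmon Mcomp Hnormal Hclosed mulQE phiU; exists x.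
- by move=> x y _ _; exact: (projM Mmon Mcomp Hnormal mulQE).
- by move=> x y ux uy; exact: (proj_fibres Mmon Mcomp Hnormal Hclosed).
- by move=> V VN; exact: (proj_open Mmon Mcomp Hnormal Hclosed mulQE fgA VN).
- by move=> V f VN Vo; exact: (proj_regular Mmon Mcomp Hnormal Hclosed mulQE fgA VN).
Qed.
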